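(* Let $\mathfrak g$ be a Lie algebra endowed with a Banach–Lie norm $\|\cdot\|_{\mathfrak g}$, and let $\alpha$ be a $\mathfrak g$-valued continuous measure of finite variation on an interval $I$, with total variation $\int\|\alpha\|_{\mathfrak g}$. Let $\mu_{\mathrm R,n}(\alpha)\in\mathfrak g$ ($n\ge1$) be the terms of the Magnus expansion of $\alpha$. Then, coefficientwise in the powers of the formal variable $T$ (i.e. for each $n\geq1$ the coefficient of $T^n$ on the left is at most the coefficient of $T^n$ on the right, the right side being expanded as a power series at $T=0$), $$\sum_{n=1}^\infty T^n\cdot\|\mu_{\mathrm R,n}(\alpha)\|_{\mathfrak g}\ \leq\ 2-2\sqrt{1-T\cdot\left(\int\|\alpha\|_{\mathfrak g}\right)}.$$ In particular, the Magnus expansion of $\alpha$ is convergent, in the sense that $\sum_{n=1}^\infty\|\mu_{\mathrm R,n}(\alpha)\|_{\mathfrak g}<+\infty$, if $\int\|\alpha\|_{\mathfrak g}<1$.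
   Context: A Banach–Lie norm on a (real or complex) Lie algebra $\mathfrak g$ is a complete norm with $\|[X,Y]\|_{\mathfrak g}\leq\|X\|_{\mathfrak g}\|Y\|_{\mathfrak g}$. Measures: a continuous measure of finite variation on a (possibly infinite) interval $I$ with values in a Banach space is a countably additive vector-valued Borel measure $\alpha$ on $I$ with $\alpha(\{t\})=0$ for all $t\in I$ and finite total variation $\int\|\alpha\|=\sup\sum_i\|\alpha(J_i)\|$, the supremum being over finite partitions of $I$ into subintervals. For example, $\alpha$ may be given by a Bochner integrable density. For a continuous $n$-linear map $P$, the integral $\int_{t_1\leq\ldots\leq t_n\in I}P(\alpha(t_1),\ldots,\alpha(t_n))$ is the integral of $P$ against the product measure over the ordered simplex, i.e. the limit of $\sum_{i_1<\ldots<i_n}P(\alpha(J_{i_1}),\ldots,\alpha(J_{i_n}))$ over ordered finite partitions $J_1<\ldots<J_N$ of $I$ into intervals, as the maximal variation of $\alpha$ on the $J_i$ tends to $0$. Time-ordered exponential: for a Banach algebra valued continuous measure $\phi$ of finite variation and a formal commuting variable $T$, $$\exp_{\mathrm R}(T\cdot\phi)=1+\sum_{n=1}^\infty T^n\int_{t_1\leq\ldots\leq t_n\in I}\phi(t_1)\cdots\phi(t_n).$$ Magnus expansion: there are unique universal commutator (Lie) polynomials $\mu_n(X_1,\ldots,X_n)$, linear in each variable, such that for every such $\phi$, as formal power series in $T$, $$\exp_{\mathrm R}(T\cdot\phi)=\exp\left(\sum_{n=1}^\infty T^n\mu_{\mathrm R,n}(\phi)\right),\qquad \mu_{\mathrm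 R,n}(\phi)=\int_{t_1\leq\ldots\leq t_n\in I}\mu_n(\phi(t_1),\ldots,\phi(t_n)).$$ Equivalently, $\mu_n(X_1,\ldots,X_n)$ is the part of $\log(\exp(X_1)\cdots\exp(X_n))$ (in noncommuting formal variables) that is linear in each of $X_1,\ldots,X_n$. E.g. $\mu_1(X_1)=X_1$, $\mu_2(X_1,X_2)=\frac12[X_1,X_2]$. Since the $\mu_n$ are Lie polynomials, $\mu_{\mathrm R,n}(\alpha)$ is defined by the same integral formula for $\mathfrak g$-valued $\alpha$. *)

(* Defs.v *)
From HB Require Import structures.
From mathcomp Require Import all_boot all_order all_algebra.
From mathcomp Require Import all_classical all_reals all_analysis.
From mathcomp Require Import complex.

Set Implicit Arguments.
Unset Strict Implicit.
Unset Printing Implicit Defensive.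

Import Order.TTheory GRing.Theory Num.Theory.
Import numFieldNormedType.Exports.

Local Open Scope classical_set_scope.
Local Open Scope ring_scope.

Variant scalar_kind := RealScalars | ComplexScalars.

Definition scalar_field (R : realType) (k : scalar_kind) : numFieldType :=
  match k with
  | RealScalars => R
  | ComplexScalars => R[i]%C
  end.

Definition scalar_re (R : realType) (k : scalar_kind) : scalar_field R k -> R :=
  match k return scalar_field R k -> R with
  | RealScalars => id
  | ComplexScalars => @complex.Re R
  end.

(* In MathComp-Analysis the norm of a [normedModType K] takes its values in K;
   these values are nonnegative, hence real, and [rnorm] reads them in R. *)
Definition rnorm (R : realType) (k : scalar_kind)
  (V : normedModType (scalar_field R k)) (x : V) : R := scalar_re `|x|.

Record lie_bracket (K : numFieldType) (g : lmodType K)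
    (br : {bilinear g -> g -> g}) : Prop := LieBracket {
  lie_alternating : forall x, br x x = 0;
  lie_jacobi : forall x y z,
    br x (br y z) + br y (br z x) + br z (br x y) = 0
}.

Definition banach_lie_norm (K : numFieldType) (g : completeNormedModType K)
  (br : {bilinear g -> g -> g}) : Prop :=
  forall x y : g, `|br x y| <= `|x| * `|y|.

Section Measures.
Variables (R : realType) (k : scalar_kind).

(* The list [s] reads J_1 < ... < J_N; empty members are harmless, since a
   vector measure vanishes on the empty set. *)
Definition ordered_partition (I : interval R) (s : seq (interval R)) : Prop :=
  [set` I] = \bigcup_(i in [set: 'I_(size s)]) [set` tnth (in_tuple s) i] /\
  forall (i j : 'I_(size s)) (x y : R), (i < j)%N ->
    x \in tnth (in_tuple s) i -> y \in tnth (in_tuple s) j -> x < y.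

Definition measure_variation (V : normedModType (scalar_field R k))
    (alpha : set R -> V) (I : interval R) : \bar R :=
  ereal_sup [set (\sum_(J <- s) rnorm (alpha [set` J]))%:E
            | s in ordered_partition I].

(* Only the values of [alpha] on the Borel subsets of [I] are relevant. *)
Record continuous_measure (V : normedModType (scalar_field R k)) (I : interval R)
    (alpha : set R -> V) : Prop := ContinuousMeasure {
  vmeasure_sigma_additive : forall F : nat -> set R,
    (forall m, measurable (F m)) -> (forall m, F m `<=` [set` I]) ->
    trivIset setT F ->
    series (fun m => alpha (F m)) @ \oo --> alpha (\bigcup_m F m);
  vmeasure_atomless : forall t, t \in I -> alpha [set t] = 0;
  vmeasure_finite_variation : (measure_variation alpha I < +oo)%E
}.

Definition simplex_sum (V W : normedModType (scalar_field R k)) (n : nat)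
    (P : ('I_n -> V) -> W) (alpha : set R -> V) (s : seq (interval R)) : W :=
  \sum_(f : {ffun 'I_n -> 'I_(size s)}
        | [forall a : 'I_n, forall b : 'I_n, (a < b)%N ==> (f a < f b)%N])
     P (fun a => alpha [set` tnth (in_tuple s) (f a)]).

Definition fine_partitions (V : normedModType (scalar_field R k))
    (alpha : set R -> V) (I : interval R) : set_system (seq (interval R)) :=
  [set A | exists2 d : R, 0 < d & forall s, ordered_partition I s ->
     (forall J, J \in s -> (measure_variation alpha J < d%:E)%E) -> A s].

Definition simplex_integral (V W : normedModType (scalar_field R k)) (n : nat)
    (P : ('I_n -> V) -> W) (alpha : set R -> V) (I : interval R) : W :=
  lim (simplex_sum P alpha s @[s --> fine_partitions alpha I]).

End Measures.

(* Formal power series in the noncommuting variables X_0, ..., X_(n-1), given by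
   their coefficients on words. *)
Section NoncommutativeSeries.
Variable n : nat.

Definition ncseries := seq 'I_n -> rat.

Definition nc_one : ncseries := fun w => (w == [::])%:R.
Definition nc_var (i : 'I_n) : ncseries := fun w => (w == [:: i])%:R.
Definition nc_mul (f g : ncseries) : ncseries := fun w =>
  \sum_(j < (size w).+1) f (take j w) * g (drop j w).
Definition nc_pow (f : ncseries) (m : nat) : ncseries :=
  iter m (nc_mul f) nc_one.

(* For f without constant term, f ^ m vanishes on the words shorter than m, so
   the truncated sums are exp f and log (1 + f). *)
Definition nc_exp (f : ncseries) : ncseries := fun w =>
  \sum_(0 <= m < (size w).+1) (m`!%:R)^-1 * nc_pow f m w.
Definition nc_log (f : ncseries) : ncseries := fun w =>
  \sum_(1 <= m < (size w).+1)
     (-1) ^+ m.-1 / m%:R * nc_pow (fun u => f u - nc_one u) m w.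

Definition multilinear_part (f : ncseries) : ncseries := fun w =>
  if perm_eq w (enum 'I_n) then f w else 0.

End NoncommutativeSeries.

(* Formal commutator polynomials; they are not quotiented by the Lie algebra
   relations, so several terms denote the same Lie polynomial. *)
Inductive lie_poly (n : nat) : Type :=
| LieVar of 'I_n
| LieZero
| LieAdd of lie_poly n & lie_poly n
| LieScale of rat & lie_poly n
| LieBr of lie_poly n & lie_poly n.

Fixpoint lie_series (n : nat) (p : lie_poly n) : ncseries n :=
  match p with
  | LieVar i => nc_var i
  | LieZero => fun=> 0
  | LieAdd q r => fun w => lie_series q w + lie_series r w
  | LieScale c q => fun w => c * lie_series q w
  | LieBr q r => fun w => nc_mul (lie_series q) (lie_series r) w
                        - nc_mul (lie_series r) (lie_series q) w
  end.

Fixpoint lie_eval (K : numFieldType) (g : lmodType K) (br : g -> g -> g)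
    (n : nat) (x : 'I_n -> g) (p : lie_poly n) : g :=
  match p with
  | LieVar i => x i
  | LieZero => 0
  | LieAdd q r => lie_eval br x q + lie_eval br x r
  | LieScale c q => ratr c *: lie_eval br x q
  | LieBr q r => br (lie_eval br x q) (lie_eval br x r)
  end.

(* [p] is the part of log (exp X_0 ... exp X_(n-1)) that is linear in each
   variable. *)
Definition magnus_poly (n : nat) (p : lie_poly n) : Prop :=
  forall w, lie_series p w =
    multilinear_part
      (nc_log (\big[@nc_mul n/@nc_one n]_(i < n) nc_exp (nc_var i))) w.

Definition magnus_term (R : realType) (k : scalar_kind)
    (g : normedModType (scalar_field R k)) (br : g -> g -> g) (n : nat)
    (p : lie_poly n) (alpha : set R -> g) (I : interval R) : g :=
  simplex_integral (fun x : 'I_n -> g => lie_eval br x p) alpha I.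

Definition taylor_coef (R : realType) (f : R -> R) (n : nat) : R :=
  (f^`(n))%classic 0 / n`!%:R.

(* Main.v *)
From HB Require Import structures.
Require Import Defs.
From mathcomp Require Import all_boot all_order all_algebra.
From mathcomp Require Import all_classical all_reals all_analysis.
From mathcomp Require Import complex.
From mathcomp Require Import ring lra zify.

Set Implicit Arguments.
Unset Strict Implicit.
Unset Printing Implicit Defensive.

Import Order.TTheory GRing.Theory Num.Theory.
Import numFieldNormedType.Exports.

Local Open Scope classical_set_scope.
Local Open Scope ring_scope.

(** Let v be the total variation of the measure. The proof bounds the norm of
the n-th Magnus term by v^n / n^2 and compares 1 / n^2 with the n-th Taylor
coefficient of 2 - 2 sqrt (1 - T).

The Magnus polynomial is known word by word. On words without repeated letters
the product exp X_0 ... exp X_(n-1) is the indicator of increasing words, so the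
m-th power of this product minus 1 counts the ways of cutting a word into m
nonempty increasing pieces. A word of length n with d descents must be cut at
its descents and may be cut at the n-1-d other places; the alternating sum that
defines the logarithm then evaluates to (-1)^d d! (n-1-d)! / n!, whose absolute
value is at most 1/n ([nc_log_prod_exp_vars_le]).

The Dynkin-Specht-Wever identity ([dynkin_specht_wever]) says that n times the
value of a Lie polynomial of degree n is the sum of its noncommutative
coefficients times right-normed brackets. It shows that the value depends on the
associated series only, and, as each bracket of x_0, ..., x_(n-1) has norm at
most the product of the norms, it bounds the n-th Magnus polynomial by
(1/n) * n! * (1/n) times that product ([magnus_eval_le]). An n-linear map with
bound M has simplex integral at most M v^n / n! ([rnorm_simplex_integral_le]),
which gives v^n / n^2.

The Taylor coefficients b_n of 2 - 2 sqrt (1 - T) satisfy b_1 = 1 and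
b_(n+1) = b_n (2n-1) / (2(n+1)), so that 1 / n^2 <= b_n follows by induction
([invsqr_le_sqrt_taylor]). When v < 1 the bound v^n / n^2 <= v^n is summable.

It remains to see that the limit defining the simplex integral exists.
Partitions of arbitrarily small mesh exist because the measure has no atoms
([exists_fine_partition]). When every member of a partition is subdivided, only
the terms that use two pieces of one member are new; they have total size at most
M v^(n-2) times the sum of the squares of the variations of the members
([list_simplex_sum_blocks]), which is small with the mesh. Passing to the common
refinement of two partitions, the simplex sums form a Cauchy family
([simplex_sum_dist]). *)

(** * Coefficients of the logarithm *)

Section LogCoefficients.
Variable n : nat.
Implicit Types (i : 'I_n) (w : seq 'I_n) (f : ncseries n).

Lemma nc_mul_one f w : nc_mul (@nc_one n) f w = f w.
Proof.
rewrite /nc_mul big_ord_recl take0 drop0 /nc_one eqxx mul1r big1 ?addr0// => j _.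
by case: w j => [[]//|x w j]; rewrite /= mul0r.
Qed.

Lemma nc_mul_var i f w :
  nc_mul (nc_var i) f w = if w is x :: w' then (x == i)%:R * f w' else 0.
Proof.
case: w => [|x w]; rewrite /nc_mul big_ord_recl /nc_var/= ?mul0r ?add0r.
  by rewrite big_ord0.
rewrite big_ord_recl /= take0 drop0 big1 ?addr0 => [|j _].
  by rewrite eqseq_cons eqxx andbT.
by case: w j => [[]//|y w j]/=; rewrite eqseq_cons andbF mul0r.
Qed.

Lemma nc_pow_var i m w : nc_pow (nc_var i) m w = (w == nseq m i)%:R.
Proof.
elim: m w => [//|m IH] w; rewrite /nc_pow iterS -/(nc_pow _ m) nc_mul_var.
by case: w => [//|x w]; rewrite IH /= eqseq_cons -natrM mulnb.
Qed.

(** The term of degree m is carried by the word of m letters [i], which has repeated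
letters as soon as m is at least 2. *)
Lemma nc_exp_var i w : uniq w ->
  nc_exp (nc_var i) w = nc_one w + nc_var i w.
Proof.
move=> uw; rewrite /nc_exp big_nat_recl// nc_pow_var fact0 invr1 mul1r.
congr (_ + _); case: w uw => [_|x [|y w] uw]; first by rewrite big_geq.
  by rewrite big_nat1 nc_pow_var factS fact0 muln1 invr1 mul1r.
rewrite /nc_var eqseq_cons andbF big1 // => m _; rewrite nc_pow_var.
case: eqP => [|_]; last by rewrite mulr0.
by case: m => [|m] [] // xi yi _; rewrite xi yi /= inE eqxx in uw.
Qed.

Lemma nc_mul_exp_var i f w : uniq w ->
  nc_mul (nc_exp (nc_var i)) f w =
  f w + if w is x :: w' then (x == i)%:R * f w' else 0.
Proof.
move=> uw; rewrite -nc_mul_var -[in RHS](nc_mul_one f w) /nc_mul -big_split/=.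
by apply: eq_bigr => j _; rewrite nc_exp_var ?take_uniq// mulrDl.
Qed.

(** Each factor contributes its letter at most once, and the factors are taken in
the order of [r]. *)
Lemma nc_prod_exp r w : uniq r -> uniq w ->
  (\big[@nc_mul n/@nc_one n]_(i <- r) nc_exp (nc_var i)) w = (subseq w r)%:R.
Proof.
elim: r w => [|i r IH] w /=; first by rewrite big_nil.
case/andP => ir ur uw; rewrite big_cons nc_mul_exp_var// IH//.
case: w uw => [|x w] uw; first by rewrite sub0seq addr0.
rewrite IH//; last by case/andP: uw.
have [->|] := eqVneq x i; last by rewrite mul0r addr0.
rewrite mul1r (_ : subseq _ _ = false) ?add0r//; apply/negP => /mem_subseq /(_ i).
by rewrite inE eqxx (negPf ir) => /(_ isT).
Qed.

Lemma subseq_enum_ord w :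
  subseq w (enum 'I_n) = sorted (fun i j : 'I_n => (i < j)%N) w.
Proof.
have tr : transitive (fun i j : 'I_n => (i < j)%N) by move=> ? ? ?; apply: ltn_trans.
have se : sorted (fun i j : 'I_n => (i < j)%N) (enum 'I_n).
  by rewrite -(@sorted_map _ _ val ltn) val_enum_ord iota_ltn_sorted.
apply/idP/idP => [/subseq_sorted|sw]; first exact.
have ir : irreflexive (fun i j : 'I_n => (i < j)%N) by move=> i; exact: ltnn.
apply/subseq_uniqP; first exact: enum_uniq.
apply: (irr_sorted_eq tr ir sw); first exact: sorted_filter.
by move=> i; rewrite mem_filter mem_enum andbT.
Qed.

Definition nc_prod_exp_vars : ncseries n :=
  \big[@nc_mul n/@nc_one n]_(i < n) nc_exp (nc_var i).

Let reduced : ncseries n := fun u => nc_prod_exp_vars u - nc_one u.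

Lemma reduced_prod_exp u : uniq u ->
  reduced u = ((u != [::]) && sorted (fun i j : 'I_n => (i < j)%N) u)%:R.
Proof.
move=> uu; rewrite /reduced /nc_prod_exp_vars nc_prod_exp ?index_enum_uniq//.
have -> : index_enum 'I_n = enum 'I_n by rewrite enumT.
rewrite subseq_enum_ord /nc_one.
by case: u uu => [|x u] _; rewrite /= ?subrr ?subr0.
Qed.

Lemma nc_pow_nil m : nc_pow reduced m [::] = (m == 0%N)%:R.
Proof.
case: m => [//|m]; rewrite /nc_pow iterS /nc_mul big_ord_recl big_ord0 /=.
by rewrite reduced_prod_exp// mul0r addr0.
Qed.

Lemma nc_powS m x w :
  nc_pow reduced m.+1 (x :: w) =
  \sum_(j < (size w).+1) reduced (x :: take j w) * nc_pow reduced m (drop j w).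
Proof.
rewrite /nc_pow iterS -/(nc_pow _ m) /nc_mul big_ord_recl/= reduced_prod_exp// mul0r add0r.
by [].
Qed.

(** The first letter [x] is either a piece of its own, or it is joined to the first
piece of the rest; the latter keeps the piece increasing exactly when [x < y]. *)
Lemma nc_pow_cons2 m x y w : uniq [:: x, y & w] ->
  nc_pow reduced m.+1 [:: x, y & w] =
  nc_pow reduced m (y :: w) + (x < y)%N%:R * nc_pow reduced m.+1 (y :: w).
Proof.
move=> u; rewrite nc_powS big_ord_recl take0 drop0 reduced_prod_exp// mul1r; congr (_ + _).
rewrite nc_powS mulr_sumr; apply: eq_bigr => j _ /=; rewrite mulrA; congr (_ * _).
have ut : uniq [:: x, y & take j w].
  by rewrite (_ : [:: x, y & _] = take j.+2 [:: x, y & w]) ?take_uniq.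
by rewrite !reduced_prod_exp//= -?natrM ?mulnb// ; case/andP: ut.
Qed.

(** The coefficient of t^m in t^d (1 + t)^e. *)
Definition shifted_bin (d e m : nat) : nat := if (m < d)%N then 0 else 'C(e, m - d).

(** Pascal's rule, that is t^d (1 + t)^(e+1) = t^d (1 + t)^e + t^(d+1) (1 + t)^e. *)
Lemma shifted_binS d e m :
  shifted_bin d e.+1 m = (shifted_bin d e m + shifted_bin d.+1 e m)%N.
Proof.
rewrite /shifted_bin ltnS; case: ltngtP => // [lt|->]; last by rewrite subnn !bin0.
by rewrite -(prednK (_ : 0 < m - d)%N) ?subn_gt0// binS subnS.
Qed.

(** Here [d] is the number of descents of the word and [e] the number of its
ascents: the cuts into increasing pieces are forced at the descents and free at
the ascents. *)
Lemma nc_pow_shifted_bin x w : uniq (x :: w) ->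
  exists d e, (d + e = size w)%N /\
    forall m, nc_pow reduced m.+1 (x :: w) = (shifted_bin d e m)%:R.
Proof.
elim: w x => [|y w IH] x u.
  exists 0%N, 0%N; split=> // m; rewrite nc_powS big_ord1 /= reduced_prod_exp// mul1r.
  by rewrite nc_pow_nil /shifted_bin ltn0 subn0 bin0n.
have [d [e [de H]]] := IH y (proj2 (andP u)).
have H0 m : nc_pow reduced m (y :: w) = (shifted_bin d.+1 e m)%:R.
  by case: m => [|m]; [rewrite /nc_pow/= /nc_one|rewrite H].
have [xy|xy] := boolP (x < y)%N.
  exists d, e.+1; rewrite addnS de; split=> // m.
  by rewrite nc_pow_cons2// xy mul1r H H0 shifted_binS natrD addrC.
exists d.+1, e; rewrite addSn de; split=> // m.
by rewrite nc_pow_cons2// (negPf xy) mul0r addr0 H0.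
Qed.

(** The sum is the integral of (-t)^d (1 - t)^e over [0, 1], a Beta integral; the
induction on [e] is the splitting (1 - t)^(e+1) = (1 - t)^e - t (1 - t)^e. *)
Lemma alternating_shifted_bin d e :
  \sum_(m < (d + e).+1) (-1) ^+ m / m.+1%:R * (shifted_bin d e m)%:R
  = (-1) ^+ d * (d`! * e`!)%:R / ((d + e).+1)`!%:R :> rat.
Proof.
elim: e d => [|e IH] d.
  rewrite addn0 big_ord_recr big1/= => [|m _]; last by rewrite /shifted_bin ltn_ord mulr0.
  rewrite /shifted_bin ltnn subnn bin0 mulr1 add0r muln1 factS mulrC natrM invfM mulrA.
  rewrite mulrAC -!mulrA [X in _ = _ * X]mulrA divff ?mul1r 1?mulrC//.
under eq_bigr do rewrite shifted_binS natrD mulrDr.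
rewrite big_split/= -[in X in _ + X]addSnnS IH addnS big_ord_recr/= IH.
rewrite {1}/shifted_bin ltnNge leqW ?leq_addr//= subSn ?leq_addr// addKn bin_small//.
rewrite mulr0 addr0 addSn !factS !natrM exprS.
have fn0 m : m`!%:R != 0 :> rat by rewrite pnatr_eq0 -lt0n fact_gt0.
have n0 m : m.+1%:R != 0 :> rat by rewrite pnatr_eq0.
have -> : (d + e).+2%:R = d.+1%:R + e.+1%:R :> rat by rewrite -natrD addSn addnS.
have n2 : d.+1%:R + e.+1%:R != 0 :> rat by rewrite -natrD pnatr_eq0.
field.
by rewrite fn0 -natrD !nat1r -natrD !pnatr_eq0 addSn.
Qed.

(** The coefficient is plus or minus d! e! / (d + e + 1)! with d + e + 1 the length
of the word, and d! e! divides (d + e)!. *)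
Lemma nc_log_prod_exp_vars_le w : uniq w -> w != [::] ->
  `|nc_log nc_prod_exp_vars w| <= (size w)%:R^-1.
Proof.
case: w => [//|x w] u _; rewrite /nc_log big_add1 big_mkord.
have [d [e [de H]]] := nc_pow_shifted_bin u.
under eq_bigr do rewrite H.
rewrite /= -de alternating_shifted_bin !normrM normrX normrN1 expr1n mul1r.
rewrite normfV !normr_nat ler_pdivrMr ?ltr0n ?fact_gt0//.
rewrite factS [in leRHS]natrM mulrA mulVf ?mul1r ?pnatr_eq0// ler_nat.
rewrite -(bin_fact (leq_addr e d)) addKn leq_pmull// bin_gt0 leq_addr.
by [].
Qed.

End LogCoefficients.

(** * The Dynkin-Specht-Wever identity *)

Section Words.
Variable T : finType.

Fixpoint words (m : nat) : seq (seq T) :=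
  if m is m'.+1 then [seq i :: w | i <- enum T, w <- words m'] else [:: [::]].

Lemma size_words m w : w \in words m -> size w = m.
Proof.
elim: m w => [|m IH] w /=; first by rewrite inE => /eqP->.
by case/allpairsP => -[i v] [_ /= /IH <- ->].
Qed.

Lemma uniq_words m : uniq (words m).
Proof.
elim: m => [//|m IH] /=; apply: allpairs_uniq => //; first exact: enum_uniq.
by move=> [i v] [j u] _ _ /= [-> ->].
Qed.

Lemma sum_words_cat (V : nmodType) a b (phi : seq T -> V) :
  \sum_(w <- words (a + b)) phi w
  = \sum_(u <- words a) \sum_(v <- words b) phi (u ++ v).
Proof.
elim: a phi => [|a IH] phi; first by rewrite big_seq1.
rewrite addSn /= !big_allpairs_dep; apply: eq_bigr => i _.
by rewrite (IH (fun w => phi (i :: w))).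
Qed.

Lemma sum_words1 (V : nmodType) (phi : seq T -> V) :
  \sum_(w <- words 1) phi w = \sum_i phi [:: i].
Proof. by rewrite big_allpairs_dep big_enum; apply: eq_bigr => i _; exact: big_seq1. Qed.

Lemma size_perm_words :
  (size [seq w <- words #|T| | perm_eq w (enum T)] <= (#|T|)`!)%N.
Proof.
have -> : (#|T|)`! = size (permutations (enum T)).
  by rewrite size_permutations ?enum_uniq// -cardE.
apply: uniq_leq_size; first by rewrite filter_uniq ?uniq_words.
by move=> w; rewrite mem_filter mem_permutations => /andP[].
Qed.

End Words.

(** Both sides run over the pairs with a + b < N. *)
Lemma sum_antidiagonals (V : nmodType) N (F : nat -> nat -> V) :
  \sum_(m < N) \sum_(a < m.+1) F a (m - a)%N = \sum_(a < N) \sum_(b < N - a) F a b.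
Proof.
rewrite -(big_mkord xpredT (fun m => \sum_(a < m.+1) F a (m - a)%N)).
transitivity (\sum_(0 <= m < N) \sum_(0 <= a < N | (a < m.+1)%N) F a (m - a)%N).
  apply: eq_big_nat => m /andP[_ mN].
  by rewrite -(big_mkord xpredT (fun a => F a (m - a)%N)) (big_nat_widen 0 m.+1 N).
rewrite (exchange_big_dep_nat xpredT)//= big_mkord; apply: eq_bigr => a _.
transitivity (\sum_(a <= m < N) F a (m - a)%N).
  by rewrite [RHS](big_nat_widenl a 0 N).
rewrite -{1}[nat_of_ord a]add0n big_addn big_mkord.
by apply: eq_bigr => b _; rewrite addnK.
Qed.

Section Dynkin.
Variables (K : numFieldType) (g : lmodType K) (br : {bilinear g -> g -> g}).
Hypothesis br_lie : lie_bracket br.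
Variables (n : nat) (x : 'I_n -> g).

Lemma lie_antisym y z : br y z = - br z y.
Proof.
have := lie_alternating br_lie (y + z).
rewrite linearDl !linearDr/= !(lie_alternating br_lie) add0r addr0.
by move/eqP; rewrite addr_eq0 => /eqP.
Qed.

Lemma lie_derivation y z t : br (br y z) t = br y (br z t) - br z (br y t).
Proof.
have /eqP := lie_jacobi br_lie y z t.
rewrite addr_eq0 => /eqP E; rewrite (lie_antisym (br y z)) -E.
by rewrite (lie_antisym t y) linearNr.
Qed.

Definition ad_word (w : seq 'I_n) (z : g) : g := foldr (fun i => br (x i)) z w.

Lemma ad_word_is_linear w : linear (ad_word w).
Proof. by elim: w => [//|i w IH] c y z /=; rewrite IH linearPr. Qed.

HB.instance Definition _ w :=
  GRing.isLinear.Build K g g *:%R (ad_word w) (ad_word_is_linear w).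

Fixpoint right_bracket (w : seq 'I_n) : g :=
  match w with
  | [::] => 0
  | [:: i] => x i
  | i :: w' => br (x i) (right_bracket w')
  end.

Lemma right_bracket_cat u v : v != [::] ->
  right_bracket (u ++ v) = ad_word u (right_bracket v).
Proof.
move=> v0; elim: u => [//|i u IH] /=; rewrite -IH.
by case: u {IH} => [|//]; case: v v0.
Qed.

(** The value of the homogeneous component of degree [m].  The series of [p] may be
homogeneous by cancellation only, so the components have to be separated before
an identity that involves the degree can be used. *)
Fixpoint lie_hom (p : lie_poly n) (m : nat) : g :=
  match p with
  | LieVar i => if m == 1%N then x i else 0
  | LieZero => 0
  | LieAdd q r => lie_hom q m + lie_hom r m
  | LieScale c q => ratr c *: lie_hom q m
  | LieBr q r => \sum_(a < m.+1) br (lie_hom q a) (lie_hom r (m - a)%N)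
  end.

Lemma lie_hom0 p : lie_hom p 0 = 0.
Proof.
elim: p => //= [q -> r ->|c q ->|q Hq r Hr]; rewrite ?addr0 ?scaler0//.
by rewrite big_ord1 Hq linear0l.
Qed.

Fixpoint lie_degree (p : lie_poly n) : nat :=
  match p with
  | LieVar _ => 1
  | LieZero => 0
  | LieAdd q r => maxn (lie_degree q) (lie_degree r)
  | LieScale _ q => lie_degree q
  | LieBr q r => lie_degree q + lie_degree r
  end.

Lemma lie_hom_eq0 p m : (lie_degree p < m)%N -> lie_hom p m = 0.
Proof.
elim: p m => [i||q Hq r Hr|c q Hq|q Hq r Hr] m //=.
- by case: eqP => // ->.
- by rewrite gtn_max => /andP[/Hq-> /Hr->]; rewrite addr0.
- by move=> /Hq->; rewrite scaler0.
move=> dm; apply: big1 => a _.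
have [qa|aq] := ltnP (lie_degree q) a; first by rewrite Hq// linear0l.
by rewrite [in X in br _ X]Hr ?linear0r//; lia.
Qed.

Lemma sum_lie_hom p N : (lie_degree p < N)%N ->
  \sum_(m < N) lie_hom p m = lie_eval br x p.
Proof.
elim: p N => [i||q Hq r Hr|c q Hq|q Hq r Hr] N //=.
- case: N => [//|[//|N]] _; rewrite !big_ord_recl/= add0r big1 ?addr0//.
- by move=> _; rewrite big1.
- by rewrite gtn_max => /andP[/Hq <- /Hr <-]; rewrite -big_split.
- by move=> /Hq <-; rewrite scaler_sumr.
move=> dN; rewrite (sum_antidiagonals _ (fun a b => br (lie_hom q a) (lie_hom r b))).
rewrite -(Hq N) ?linear_sumlz; last lia.
apply: eq_bigr => a _.
have [qa|aq] := ltnP (lie_degree q) a.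
  rewrite lie_hom_eq0// linear0l big1// => b _; exact: linear0l.
by rewrite -linear_sumr Hr//; lia.
Qed.

Definition word_sum (f : ncseries n) (m : nat) (phi : seq 'I_n -> g) : g :=
  \sum_(w <- words 'I_n m) ratr (f w) *: phi w.

Lemma word_sum_mul (f h : ncseries n) m phi :
  word_sum (nc_mul f h) m phi = \sum_(j < m.+1)
    word_sum f j (fun u => word_sum h (m - j) (fun v => phi (u ++ v))).
Proof.
rewrite /word_sum.
under eq_big_seq => w /size_words sw.
  rewrite /nc_mul sw rmorph_sum scaler_suml/=.
  over.
rewrite exchange_big/=; apply: eq_bigr => j _.
rewrite -{1}(subnKC (_ : j <= m)%N) -1?ltnS// sum_words_cat.
apply: eq_big_seq => u /size_words su; rewrite scaler_sumr; apply: eq_bigr => v _.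
by rewrite -su take_size_cat// drop_size_cat// rmorphM scalerA.
Qed.

(** Brackets go to commutators under the adjoint representation: the endomorphism
obtained by substituting the operators [br (x i)] for the letters is the bracket
with the value of [p], degree by degree. *)
Lemma ad_series p m z :
  word_sum (lie_series p) m (ad_word^~ z) = br (lie_hom p m) z.
Proof.
elim: p m z => [i||q Hq r Hr|c q Hq|q Hq r Hr] m z /=.
- case: eqP => [->|/eqP m1].
    rewrite /word_sum sum_words1 (bigD1 i)//=.
    rewrite /nc_var eqxx rmorph1 scale1r big1 ?addr0// => j ji.
    by rewrite eqseq_cons (negPf ji) rmorph0 scale0r.
  rewrite linear0l /word_sum big_seq big1// => w /size_words sw.
  rewrite /nc_var; case: eqP => [wi|_]; last by rewrite rmorph0 scale0r.
  by rewrite -sw wi in m1.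
- by rewrite linear0l /word_sum big1// => w _; rewrite rmorph0 scale0r.
- rewrite linearDl -Hq -Hr /word_sum -big_split; apply: eq_bigr => w _.
  by rewrite rmorphD scalerDl.
- rewrite linearZl_LR -Hq /word_sum scaler_sumr; apply: eq_bigr => w _.
  by rewrite rmorphM scalerA.
have E q1 r1 : (forall m z, word_sum (lie_series q1) m (ad_word^~ z) = br (lie_hom q1 m) z) ->
    (forall m z, word_sum (lie_series r1) m (ad_word^~ z) = br (lie_hom r1 m) z) ->
    word_sum (nc_mul (lie_series q1) (lie_series r1)) m (ad_word^~ z)
    = \sum_(j < m.+1) br (lie_hom q1 j) (br (lie_hom r1 (m - j)) z).
  move=> H1 H2; rewrite word_sum_mul; apply: eq_bigr => j _; rewrite -H1 -H2.
  apply: eq_bigr => u _; congr (_ *: _).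
  rewrite [in RHS]/word_sum linear_sum; apply: eq_bigr => v _.
  by rewrite linearZ /ad_word foldr_cat.
transitivity (word_sum (nc_mul (lie_series q) (lie_series r)) m (ad_word^~ z)
  - word_sum (nc_mul (lie_series r) (lie_series q)) m (ad_word^~ z)).
  rewrite /word_sum -sumrB; apply: eq_bigr => w _.
  by rewrite rmorphB scalerBl.
rewrite !E// [in X in _ - X](reindex_inj rev_ord_inj) -sumrB linear_sumlz.
apply: eq_bigr => j _; rewrite lie_derivation /= subSS subKn// -ltnS//.
Qed.

Lemma lie_series_nil (p : lie_poly n) : lie_series p [::] = 0.
Proof.
elim: p => //= [q -> r ->|c q ->|q Hq r Hr]; rewrite ?addr0 ?mulr0//.
by rewrite /nc_mul !big_ord1 /= Hq Hr !mulr0 subrr.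
Qed.

(** Right-normed bracketing sends q r to ad q applied to the bracketing of r.  By
induction it sends a commutator q r - r q of degrees a and b to
[q, b r] - [r, a q] = (a + b) [q, r]. *)
Lemma dynkin_hom p m :
  word_sum (lie_series p) m right_bracket = m%:R *: lie_hom p m.
Proof.
elim: p m => [i||q Hq r Hr|c q Hq|q Hq r Hr] m /=.
- case: eqP => [->|/eqP m1].
    rewrite /word_sum sum_words1 (bigD1 i)//=.
    rewrite /nc_var eqxx rmorph1 scale1r big1 ?addr0 ?scale1r// => j ji.
    by rewrite eqseq_cons (negPf ji) rmorph0 scale0r.
  rewrite scaler0 /word_sum big_seq big1// => w /size_words sw.
  rewrite /nc_var; case: eqP => [wi|_]; last by rewrite rmorph0 scale0r.
  by rewrite -sw wi in m1.
- by rewrite scaler0 /word_sum big1// => w _; rewrite rmorph0 scale0r.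
- rewrite scalerDr -Hq -Hr /word_sum -big_split; apply: eq_bigr => w _.
  by rewrite rmorphD scalerDl.
- rewrite scalerA mulrC -scalerA -Hq /word_sum scaler_sumr; apply: eq_bigr => w _.
  by rewrite rmorphM scalerA.
have E q1 r1 : (forall m, word_sum (lie_series r1) m right_bracket = m%:R *: lie_hom r1 m) ->
    word_sum (nc_mul (lie_series q1) (lie_series r1)) m right_bracket
    = \sum_(j < m.+1) (m - j)%:R *: br (lie_hom q1 j) (lie_hom r1 (m - j)).
  move=> H2; rewrite word_sum_mul; apply: eq_bigr => j _.
  rewrite -linearZr_LR/= -H2 -ad_series.
  apply: eq_bigr => u _; congr (_ *: _).
  rewrite [in RHS]/word_sum linear_sum; apply: eq_bigr => v _.
  rewrite linearZZ; have [->|v0] := eqVneq v [::].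
    by rewrite lie_series_nil rmorph0 !scale0r.
  by rewrite right_bracket_cat.
transitivity (word_sum (nc_mul (lie_series q) (lie_series r)) m right_bracket
  - word_sum (nc_mul (lie_series r) (lie_series q)) m right_bracket).
  rewrite /word_sum -sumrB; apply: eq_bigr => w _.
  by rewrite rmorphB scalerBl.
rewrite !E// [in X in _ - X](reindex_inj rev_ord_inj) -sumrB scaler_sumr.
apply: eq_bigr => j _; rewrite /= subSS subKn -1?ltnS//.
rewrite (lie_antisym (lie_hom r _)) scalerN opprK -scalerDl -natrD subnK// -ltnS//.
Qed.

(** Since m times the m-th component is read off from the words of length m, only
the component of degree [n] survives. *)
Lemma dynkin_specht_wever p : (0 < n)%N ->
    (forall w, size w != n -> lie_series p w = 0) ->
  n%:R *: lie_eval br x p = word_sum (lie_series p) n right_bracket.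
Proof.
move=> n0 hom; rewrite dynkin_hom; congr (_ *: _).
rewrite -(sum_lie_hom (N := (maxn (lie_degree p) n).+1)); last by rewrite ltnS leq_maxl.
have nN : (n < (maxn (lie_degree p) n).+1)%N by rewrite ltnS leq_maxr.
rewrite (bigD1 (Ordinal nN))//= big1 ?addr0// => m mn.
have [->|m0] := eqVneq (m : nat) 0%N; first by rewrite lie_hom0.
have /eqP := dynkin_hom p m; rewrite eq_sym /word_sum big_seq big1.
  by rewrite scaler_eq0 pnatr_eq0 (negPf m0) => /eqP.
move=> w /size_words sw; rewrite hom ?rmorph0 ?scale0r// sw.
by apply: contra mn => /eqP mn; apply/eqP/val_inj.
Qed.

End Dynkin.

(** * Real-valued norms *)

Section RealNorm.
Variables (R : realType) (k : scalar_kind).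
Let K := scalar_field R k.

Lemma scalar_reD (a b : K) : scalar_re (a + b) = scalar_re a + scalar_re b.
Proof. by rewrite /K in a b *; case: k a b => //= -[a ?] [b ?]. Qed.

Lemma scalar_re_ge0 (a : K) : 0 <= a -> 0 <= scalar_re a.
Proof. by rewrite /K in a *; case: k a => //= -[a b]; rewrite lecE => /andP[]. Qed.

Lemma scalar_reM (a b : K) : 0 <= a ->
  scalar_re (a * b) = scalar_re a * scalar_re b.
Proof.
rewrite /K in a b *; case: k a b => //= -[a b] [c d] /=.
by rewrite lecE/= => /andP[/eqP-> _]; rewrite mul0r subr0.
Qed.

Lemma ler_scalar_re (a b : K) : a <= b -> scalar_re a <= scalar_re b.
Proof.
by move=> ab; rewrite -[b](subrK a) scalar_reD lerDr scalar_re_ge0// subr_ge0.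
Qed.

(** Nonnegative complex numbers are real, so their order is that of real parts. *)
Lemma ltr_of_scalar_re (a b : K) : 0 <= a -> 0 <= b ->
  scalar_re a < scalar_re b -> a < b.
Proof.
rewrite /K in a b *; case: k a b => //= -[a a'] [b b'] /=; rewrite !lecE ltcE/=.
by move=> /andP[/eqP-> _] /andP[/eqP-> _] ->; rewrite eqxx.
Qed.

Lemma scalar_re_gt0 (a : K) : 0 < a -> 0 < scalar_re a.
Proof. by rewrite /K in a *; case: k a => //= -[a b]; rewrite ltcE => /andP[]. Qed.

Lemma scalar_re_ratr (q : rat) : scalar_re (ratr q : K) = ratr q.
Proof.
rewrite /K; case: k => //=.
by rewrite -(fmorph_rat (real_complex R)).
Qed.

Definition real_scalar (r : R) : K :=
  match k return scalar_field R k with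
  | RealScalars => r
  | ComplexScalars => (r%:C)%C
  end.

Lemma scalar_reK (r : R) : scalar_re (real_scalar r) = r.
Proof. by rewrite /real_scalar; case: k. Qed.

Lemma real_scalar_gt0 (r : R) : 0 < r -> 0 < real_scalar r.
Proof. by rewrite /real_scalar /K; case: k => //= r0; rewrite ltcR. Qed.

Variable V : normedModType K.
Implicit Types x y : V.

Lemma rnorm_ge0 x : 0 <= rnorm x. Proof. by rewrite scalar_re_ge0. Qed.

Lemma rnorm0 : rnorm (0 : V) = 0.
Proof. by rewrite /rnorm normr0 /K; case: k. Qed.

Lemma rnormD x y : rnorm (x + y) <= rnorm x + rnorm y.
Proof. by rewrite /rnorm -scalar_reD ler_scalar_re// ler_normD. Qed.

Lemma rnormN x : rnorm (- x) = rnorm x.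
Proof. by rewrite /rnorm normrN. Qed.

Lemma rnorm_distC x y : rnorm (x - y) = rnorm (y - x).
Proof. by rewrite /rnorm distrC. Qed.

Lemma rnorm_sum I (r : seq I) (P : pred I) (F : I -> V) :
  rnorm (\sum_(i <- r | P i) F i) <= \sum_(i <- r | P i) rnorm (F i).
Proof.
elim/big_rec2: _ => [|i y x _ IH]; first by rewrite rnorm0.
by rewrite (le_trans (rnormD _ _))// lerD2l.
Qed.

Lemma rnormZ_rat (q : rat) x : rnorm (ratr q *: x) = ratr `|q| * rnorm x.
Proof.
by rewrite /rnorm normrZ scalar_reM// -ratr_norm scalar_re_ratr.
Qed.

Lemma rnorm_lt (e : K) x : 0 < e -> rnorm x < scalar_re e -> `|x| < e.
Proof. by move=> e0; apply: ltr_of_scalar_re => //; exact: ltW. Qed.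

Lemma rnorm_lt_real (r : R) x : `|x| < real_scalar r -> rnorm x < r.
Proof.
rewrite -subr_gt0 => /scalar_re_gt0; rewrite scalar_reD scalar_reK.
rewrite -(mulN1r `|x|) mulrC scalar_reM//.
have -> : scalar_re (-1 : K) = -1 by rewrite /K; case: k.
by rewrite mulrN1 subr_gt0.
Qed.

End RealNorm.

(** * Simplex sums over lists of vectors *)

Section Subsequences.
Variable T : Type.

(** Subsequences are listed by position: equal entries of [v] are told apart. *)
Fixpoint subseqs_of (n : nat) (v : seq T) : seq (seq T) :=
  match n, v with
  | 0, _ => [:: [::]]
  | _.+1, [::] => [::]
  | n'.+1, x :: v' => subseqs_of n v' ++ [seq x :: u | u <- subseqs_of n' v']
  end.

Lemma subseqs_of0 v : subseqs_of 0 v = [:: [::]].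
Proof. by case: v. Qed.

Lemma subseqs_ofS n x v : subseqs_of n.+1 (x :: v) =
  subseqs_of n.+1 v ++ [seq x :: u | u <- subseqs_of n v].
Proof. by []. Qed.

End Subsequences.

Lemma subseqs_of_map (T S : Type) (h : T -> S) n v :
  subseqs_of n (map h v) = map (map h) (subseqs_of n v).
Proof.
elim: v n => [|x v IH] [|n]//=.
by rewrite map_cat !IH -!map_comp.
Qed.

Lemma mem_subseqs_of (T : eqType) n (v u : seq T) :
  (u \in subseqs_of n v) = (size u == n) && subseq u v.
Proof.
elim: v n u => [|x v IH] [|n] u; rewrite ?subseqs_of0.
- by rewrite inE -size_eq0; case: u.
- by case: u => [|y u] /=; rewrite ?andbF.
- by rewrite inE -size_eq0; case: eqP => // /size0nil->.
rewrite subseqs_ofS mem_cat IH.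
case: u => [|y u]; first by apply/negbTE/negP => /orP[//|/mapP[]].
rewrite [subseq _ (x :: _)]/=; have [->|yx] := eqVneq y x.
  rewrite mem_map ?IH; last by move=> ? ? [].
  rewrite eqSS; case: eqP => //= _.
  apply/orP/idP => [[|//]|]; last by right.
  by apply: subseq_trans; exact: subseq_cons.
rewrite orb_idr// => /mapP[z _ [yx' _]]; by rewrite yx' eqxx in yx.
Qed.

Lemma uniq_subseqs_of (T : eqType) n (v : seq T) : uniq v -> uniq (subseqs_of n v).
Proof.
elim: v n => [|x v IH] [|n]//= /andP[xv uv].
rewrite cat_uniq !map_inj_uniq ?IH ?andbT//=; last by move=> ? ? [].
apply/hasPn => _ /mapP[u _ ->]; rewrite mem_subseqs_of; apply/negP => /andP[_].
by move/mem_subseq/(_ x); rewrite mem_head => /(_ isT); exact/negP.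
Qed.

Section ListSimplexSums.
Variables (R : realType) (k : scalar_kind).
Variables (V W : normedModType (scalar_field R k)).
Implicit Types (P : seq V -> W) (M : R) (v : seq V).

Definition list_simplex_sum P n v : W := \sum_(u <- subseqs_of n v) P u.
Definition total_norm v : R := \sum_(x <- v) rnorm x.

Lemma total_norm_cons x v : total_norm (x :: v) = rnorm x + total_norm v.
Proof. exact: big_cons. Qed.

Lemma total_norm_cat v w : total_norm (v ++ w) = total_norm v + total_norm w.
Proof. exact: big_cat. Qed.

Lemma total_norm_ge0 v : 0 <= total_norm v.
Proof. by apply: sumr_ge0 => x _; exact: rnorm_ge0. Qed.

Lemma list_simplex_sum0 P v : list_simplex_sum P 0 v = P [::].
Proof. by rewrite /list_simplex_sum subseqs_of0 big_seq1. Qed.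

Lemma list_simplex_sum_nil P n : list_simplex_sum P n.+1 [::] = 0.
Proof. exact: big_nil. Qed.

Lemma list_simplex_sum_cons P n x v : list_simplex_sum P n.+1 (x :: v) =
  list_simplex_sum P n.+1 v + list_simplex_sum (fun u => P (x :: u)) n v.
Proof. by rewrite /list_simplex_sum subseqs_ofS big_cat big_map. Qed.

Record bounded_multilinear P (n : nat) M : Prop := BoundedMultilinear {
  bm_ge0 : 0 <= M;
  bm_add : forall l1 a b l2, (size l1 + size l2).+1 = n ->
    P (l1 ++ (a + b) :: l2) = P (l1 ++ a :: l2) + P (l1 ++ b :: l2);
  bm_le : forall l, size l = n -> rnorm (P l) <= M * \prod_(x <- l) rnorm x
}.

Lemma bounded_multilinear_cons P n M x : bounded_multilinear P n.+1 M ->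
  bounded_multilinear (fun u => P (x :: u)) n (M * rnorm x).
Proof.
case=> M0 Padd Ple; split=> [|l1 a b l2 s|l s].
- by rewrite mulr_ge0// rnorm_ge0.
- by rewrite -!cat_cons Padd//= addSn s.
- by have := Ple (x :: l); rewrite big_cons mulrA; apply; rewrite /= s.
Qed.

(** The right-hand side expands into nonnegative terms, the first two of which are
on the left. *)
Lemma expr_tangent_le (x S : R) n : 0 <= x -> 0 <= S ->
  S ^+ n.+1 + n.+1%:R * x * S ^+ n <= (x + S) ^+ n.+1.
Proof.
move=> x0 S0; elim: n => [|n IH]; first by rewrite !expr1 expr0 mulr1 mul1r addrC.
have Sn : 0 <= S ^+ n by exact: exprn_ge0.
rewrite [leRHS]exprS; apply: (le_trans (y := (x + S) * (S ^+ n.+1 + n.+1%:R * x * S ^+ n))).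
  rewrite !exprS -subr_ge0.
  rewrite (_ : _ - _ = n.+1%:R * (x * x * S ^+ n)); last by ring.
  by rewrite !mulr_ge0.
by rewrite ler_wpM2l// addr_ge0.
Qed.

(** The elementary symmetric polynomial e_n of nonnegative reals is at most the n-th
power of their sum divided by n!. *)
Lemma list_simplex_sum_le P n M v : bounded_multilinear P n M ->
  n`!%:R * rnorm (list_simplex_sum P n v) <= M * total_norm v ^+ n.
Proof.
elim: v P n M => [|x v IH] P [|n] M bP.
- by rewrite list_simplex_sum0 mul1r expr0 (le_trans (bm_le bP _))// big_nil.
- by rewrite list_simplex_sum_nil rnorm0 mulr0 mulr_ge0 ?exprn_ge0 ?total_norm_ge0// (bm_ge0 bP).
- by rewrite list_simplex_sum0 mul1r expr0 (le_trans (bm_le bP _))// big_nil.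
rewrite list_simplex_sum_cons.
apply: (le_trans (ler_wpM2l (ler0n _ _) (rnormD _ _))).
rewrite mulrDr factS natrM -[X in _ + X]mulrA -natrM -factS.
have IHx := ler_wpM2l (ler0n _ n.+1) (IH _ _ _ (bounded_multilinear_cons x bP)).
apply: (le_trans (lerD (IH _ _ _ bP) IHx)).
rewrite total_norm_cons.
apply: (le_trans _ (ler_wpM2l (bm_ge0 bP) (expr_tangent_le n (rnorm_ge0 x) (total_norm_ge0 v)))).
by rewrite mulrDr lerD2l le_eqVlt; apply/orP; left; apply/eqP; ring.
Qed.

Lemma bm_zero P n M l1 l2 : bounded_multilinear P n M ->
  (size l1 + size l2).+1 = n -> P (l1 ++ 0 :: l2) = 0.
Proof.
move=> bP s; have := bm_add bP 0 0 s.
by rewrite addr0 => /eqP; rewrite -subr_eq0 opprD addNKr oppr_eq0 => /eqP.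
Qed.

Lemma list_simplex_sum_filter P n M v : bounded_multilinear P n M ->
  list_simplex_sum P n [seq x <- v | x != 0] = list_simplex_sum P n v.
Proof.
elim: v P n M => [//|x v IH] P [|n] M bP; first by rewrite !list_simplex_sum0.
rewrite /=; case: eqP => [->|_] /=; rewrite !list_simplex_sum_cons.
  rewrite (IH _ _ _ bP) [X in _ = _ + X]big_seq big1 ?addr0// => u.
  rewrite mem_subseqs_of => /andP[/eqP su _].
  by rewrite (bm_zero (l1 := [::]) bP)//= su.
by rewrite (IH _ _ _ bP) (IH _ _ _ (bounded_multilinear_cons x bP)).
Qed.

Lemma list_simplex_sum_skip0 P n M v1 v2 : bounded_multilinear P n M ->
  list_simplex_sum P n (v1 ++ 0 :: v2) = list_simplex_sum P n (v1 ++ v2).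
Proof.
move=> bP; rewrite -(list_simplex_sum_filter _ bP).
by rewrite filter_cat /= eqxx -filter_cat (list_simplex_sum_filter _ bP).
Qed.

(** With fewer than two arguments no term can use both pieces. *)
Lemma list_simplex_sum_split_small P n M v1 a b v2 : (n < 2)%N ->
  bounded_multilinear P n M ->
  list_simplex_sum P n (v1 ++ (a + b) :: v2) =
  list_simplex_sum P n (v1 ++ [:: a, b & v2]).
Proof.
case: n => [|[|//]] _ bP; first by rewrite !list_simplex_sum0.
elim: v1 => [|x v1 IH]; rewrite /= !list_simplex_sum_cons !list_simplex_sum0.
  rewrite (@bm_add _ _ _ bP [::] _ _ [::])//= -addrA.
  by congr (_ + _); rewrite addrC.
by rewrite IH.
Qed.

(** By linearity, the only terms that do not match are those in which the two pieces
occupy consecutive arguments. *)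
Lemma list_simplex_sum_split P n M v1 a b v2 : bounded_multilinear P n.+2 M ->
  rnorm (list_simplex_sum P n.+2 (v1 ++ (a + b) :: v2) -
         list_simplex_sum P n.+2 (v1 ++ [:: a, b & v2]))
  <= M * rnorm a * rnorm b * (total_norm v1 + total_norm v2) ^+ n.
Proof.
elim: v1 P n M => [|x v1 IH] P n M bP.
  rewrite /= !list_simplex_sum_cons /total_norm big_nil add0r -/(total_norm v2).
  have -> : list_simplex_sum (fun u => P (a + b :: u)) n.+1 v2 =
      list_simplex_sum (fun u => P (a :: u)) n.+1 v2 +
      list_simplex_sum (fun u => P (b :: u)) n.+1 v2.
    rewrite /list_simplex_sum -big_split; apply: eq_big_seq => u.
    rewrite mem_subseqs_of => /andP[/eqP su _] /=.
    by rewrite (@bm_add _ _ _ bP [::])//= su.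
  set A := list_simplex_sum _ _ _; set B := list_simplex_sum _ _ _.
  set C := list_simplex_sum _ _ _; set D := list_simplex_sum _ _ _.
  have -> : A + (B + C) - (A + C + (B + D)) = - D.
    by rewrite (addrC B) addrA [A + C + (B + D)]addrA opprD addNKr.
  rewrite rnormN.
  have bD := bounded_multilinear_cons b (bounded_multilinear_cons a bP).
  apply: le_trans (list_simplex_sum_le _ bD).
  by rewrite ler_peMl ?rnorm_ge0// ler1n fact_gt0.
rewrite /= !list_simplex_sum_cons opprD addrACA.
apply: (le_trans (rnormD _ _)).
have M0 := bm_ge0 bP.
have ab0 : 0 <= M * rnorm a * rnorm b by rewrite !mulr_ge0 ?rnorm_ge0.
have E0 : 0 <= total_norm v1 + total_norm v2 by rewrite addr_ge0 ?total_norm_ge0.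
have bx := bounded_multilinear_cons x bP.
case: n => [|n] in bP bx *.
  rewrite (list_simplex_sum_split_small _ _ _ _ _ bx)// subrr rnorm0 addr0.
  by rewrite !expr0; have := IH _ _ _ bP; rewrite expr0.
apply: (le_trans (lerD (IH _ _ _ bP) (IH _ _ _ bx))).
rewrite total_norm_cons -addrA; set E := _ + total_norm v2.
apply: (le_trans (y := M * rnorm a * rnorm b * (E ^+ n.+1 + n.+1%:R * rnorm x * E ^+ n))).
  rewrite mulrDr lerD2l.
  rewrite (_ : M * rnorm x * _ * _ * _ = M * rnorm a * rnorm b * (rnorm x * E ^+ n)); last by ring.
  rewrite ler_wpM2l// -mulrA ler_peMl ?ler1n// mulr_ge0 ?rnorm_ge0// exprn_ge0//.
by rewrite ler_wpM2l// expr_tangent_le// rnorm_ge0.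
Qed.

Lemma list_simplex_sum_split_le P n M v1 a b v2 L : bounded_multilinear P n M ->
  total_norm v1 + total_norm v2 <= L ->
  rnorm (list_simplex_sum P n (v1 ++ (a + b) :: v2) -
         list_simplex_sum P n (v1 ++ [:: a, b & v2]))
  <= M * L ^+ (n - 2) * (rnorm a * rnorm b).
Proof.
move=> bP EL.
have E0 : 0 <= total_norm v1 + total_norm v2 by rewrite addr_ge0 ?total_norm_ge0.
have M0 := bm_ge0 bP.
have [n2|] := ltnP n 2.
  rewrite (list_simplex_sum_split_small _ _ _ _ n2 bP) subrr rnorm0.
  by rewrite !mulr_ge0 ?rnorm_ge0// exprn_ge0// (le_trans E0).
case: n bP => [//|[//|n]] bP _; rewrite !subSS subn0.
apply: (le_trans (list_simplex_sum_split _ _ _ _ bP)).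
rewrite [leRHS]mulrAC -!mulrA !ler_wpM2l ?rnorm_ge0//.
by rewrite lerXn2r// nnegrE// (le_trans E0).
Qed.

(** The pieces of [u] are split off one at a time; the errors |a| (|b| + |c| + ...)
add up to at most the square of the sum of the norms. *)
Lemma list_simplex_sum_block P n M v1 u v2 L : bounded_multilinear P n M ->
  total_norm (v1 ++ u ++ v2) <= L ->
  rnorm (list_simplex_sum P n (v1 ++ (\sum_(x <- u) x) :: v2) -
         list_simplex_sum P n (v1 ++ u ++ v2))
  <= M * L ^+ (n - 2) * total_norm u ^+ 2.
Proof.
move=> bP; have M0 := bm_ge0 bP.
elim: u v1 => [|a u IH] v1 uL.
  rewrite big_nil (list_simplex_sum_skip0 _ _ bP) subrr rnorm0.
  by rewrite !mulr_ge0 ?exprn_ge0 ?total_norm_ge0// (le_trans _ uL) ?total_norm_ge0.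
have L0 : 0 <= L by rewrite (le_trans _ uL) ?total_norm_ge0.
have ML : 0 <= M * L ^+ (n - 2) by rewrite mulr_ge0 ?exprn_ge0.
rewrite big_cons.
set X := list_simplex_sum _ _ _; set Z := list_simplex_sum _ _ (_ ++ _ ++ _).
pose Y := list_simplex_sum P n (v1 ++ [:: a, \sum_(x <- u) x & v2]).
rewrite -(subrKA Y); apply: (le_trans (rnormD _ _)).
move: uL; rewrite !total_norm_cat total_norm_cons => uL.
have h1 : rnorm (X - Y) <= M * L ^+ (n - 2) * (rnorm a * rnorm (\sum_(x <- u) x)).
  apply: list_simplex_sum_split_le => //.
  by have := total_norm_ge0 u; have := rnorm_ge0 a; lra.
have h2 : rnorm (Y - Z) <= M * L ^+ (n - 2) * total_norm u ^+ 2.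
  have := IH (rcons v1 a); rewrite !cat_rcons; apply.
  by rewrite !total_norm_cat total_norm_cons total_norm_cat; lra.
apply: (le_trans (lerD h1 h2)); rewrite -mulrDr ler_wpM2l//.
have := rnorm_sum u xpredT id; rewrite -/(total_norm u).
by have := total_norm_ge0 u; have := rnorm_ge0 a; nra.
Qed.

Lemma total_norm_blocks ss :
  total_norm [seq \sum_(x <- u) x | u <- ss] <= total_norm (flatten ss).
Proof.
elim: ss => [//|u ss IH]; rewrite /= total_norm_cons total_norm_cat lerD//.
exact: rnorm_sum.
Qed.

Lemma list_simplex_sum_blocks P n M ss v1 L d : bounded_multilinear P n M ->
  total_norm (v1 ++ flatten ss) <= L ->
  (forall u, u \in ss -> total_norm u <= d) ->
  rnorm (list_simplex_sum P n (v1 ++ [seq \sum_(x <- u) x | u <- ss]) -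
         list_simplex_sum P n (v1 ++ flatten ss))
  <= M * L ^+ (n - 2) * (d * total_norm (flatten ss)).
Proof.
move=> bP; have M0 := bm_ge0 bP.
elim: ss v1 => [|u ss IH] v1 uL ud.
  by rewrite subrr rnorm0 /total_norm big_nil !mulr0.
have L0 : 0 <= L by rewrite (le_trans _ uL) ?total_norm_ge0.
have ML : 0 <= M * L ^+ (n - 2) by rewrite mulr_ge0 ?exprn_ge0.
rewrite /=; set X := list_simplex_sum _ _ _; set Z := list_simplex_sum _ _ (_ ++ _ ++ _).
pose Y := list_simplex_sum P n (v1 ++ u ++ [seq \sum_(x <- u) x | u <- ss]).
rewrite -(subrKA Y); apply: (le_trans (rnormD _ _)).
have h1 : rnorm (X - Y) <= M * L ^+ (n - 2) * total_norm u ^+ 2.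
  apply: list_simplex_sum_block => //.
  apply: le_trans uL; rewrite /= !total_norm_cat !lerD2l.
  exact: total_norm_blocks.
have h2 : rnorm (Y - Z) <= M * L ^+ (n - 2) * (d * total_norm (flatten ss)).
  rewrite /Y /Z !catA; apply: IH; first by rewrite -catA.
  by move=> w wss; apply: ud; rewrite inE wss orbT.
apply: (le_trans (lerD h1 h2)); rewrite -mulrDr ler_wpM2l// total_norm_cat mulrDr.
by rewrite lerD2r expr2 ler_wpM2r ?total_norm_ge0// ud// mem_head.
Qed.

End ListSimplexSums.

(** * The bound on Magnus polynomials *)

Section RightBrackets.
Variables (R : realType) (k : scalar_kind).
Variables (g : normedModType (scalar_field R k)) (br : {bilinear g -> g -> g}).
Variable n : nat.
Implicit Types (x y z : 'I_n -> g) (w : seq 'I_n).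

Lemma eq_right_bracket x y w : {in w, x =1 y} ->
  right_bracket br x w = right_bracket br y w.
Proof.
elim: w => [//|i [|j w] IH] xy /=; rewrite (xy i) ?mem_head//.
by congr (br _ _); apply: IH => l lw; apply: xy; rewrite inE lw orbT.
Qed.

(** The letters on the left of [i] act by linear maps, and the bracket of those on its
right does not involve [i] again. *)
Lemma right_bracketD x y z i w : uniq w -> i \in w ->
  x i = y i + z i -> (forall j, j != i -> y j = x j /\ z j = x j) ->
  right_bracket br x w = right_bracket br y w + right_bracket br z w.
Proof.
move=> + + xi xj; elim: w => [//|j w IH] /andP[jw uw] iw.
have [ji|ji] := eqVneq j i; last first.
  have {}iw : i \in w by move: iw; rewrite inE eq_sym (negPf ji).
  have [yj zj] := xj j ji.
  case: w iw uw jw IH => [//|l w] iw uw jw IH.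
  by rewrite [LHS]/= -/(right_bracket br x (l :: w)) IH// linearDr -{1}yj -{1}zj.
rewrite ji in jw *.
have wi l : l \in w -> y l = x l /\ z l = x l.
  by move=> lw; apply: xj; apply: contraNneq jw => <-.
have yw : right_bracket br y w = right_bracket br x w.
  by apply: eq_right_bracket => l /wi[].
have zw : right_bracket br z w = right_bracket br x w.
  by apply: eq_right_bracket => l /wi[].
case: w {uw jw IH iw wi} yw zw => [|l w] yw zw; first by rewrite /= xi.
rewrite [LHS]/= -/(right_bracket br x (l :: w)) xi linearDl.
by congr (_ + _); [rewrite -yw|rewrite -zw].
Qed.

Hypothesis br_le : forall a b : g, `|br a b| <= `|a| * `|b|.

Lemma rnorm_right_bracket x w : w != [::] ->
  rnorm (right_bracket br x w) <= \prod_(i <- w) rnorm (x i).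
Proof.
elim: w => [//|i [|j w] IH] _; first by rewrite big_seq1.
rewrite big_cons [X in rnorm X]/= -/(right_bracket br x (j :: w)).
apply: le_trans (ler_wpM2l (rnorm_ge0 _) (IH isT)).
by rewrite /rnorm -scalar_reM// ler_scalar_re.
Qed.

End RightBrackets.

Section MagnusPolynomials.
Variables (R : realType) (k : scalar_kind).
Variables (g : normedModType (scalar_field R k)) (br : {bilinear g -> g -> g}).
Hypothesis br_lie : lie_bracket br.
Hypothesis br_le : forall a b : g, `|br a b| <= `|a| * `|b|.
Variables (n : nat) (p : lie_poly n).
Hypotheses (n_gt0 : (0 < n)%N) (p_magnus : magnus_poly p).

Lemma magnus_coef0 w : ~~ perm_eq w (enum 'I_n) -> lie_series p w = 0.
Proof. by rewrite p_magnus /multilinear_part => /negPf ->. Qed.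

Lemma magnus_coef_le w : `|lie_series p w| <= n%:R^-1.
Proof.
rewrite p_magnus /multilinear_part; case: ifP => pw; last by rewrite normr0 invr_ge0.
have sw : size w = n by rewrite (perm_size pw) size_enum_ord.
rewrite -[in leRHS]sw; apply: nc_log_prod_exp_vars_le.
  by rewrite (perm_uniq pw) enum_uniq.
by rewrite -size_eq0 sw -lt0n.
Qed.

Lemma magnus_eval (x : 'I_n -> g) :
  lie_eval br x p = n%:R^-1 *: word_sum (lie_series p) n (right_bracket br x).
Proof.
rewrite -(dynkin_specht_wever br_lie)//.
  by rewrite scalerA mulVf ?scale1r// pnatr_eq0 -lt0n.
move=> w sw; apply: magnus_coef0; apply: contra sw => /perm_size ->.
by rewrite size_enum_ord.
Qed.

(** At most n! words contribute, each with a coefficient of size at most 1/n, and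
the Dynkin-Specht-Wever identity supplies another factor 1/n. *)
Lemma magnus_eval_le (x : 'I_n -> g) :
  rnorm (lie_eval br x p) <= n`!%:R / n%:R ^+ 2 * \prod_i rnorm (x i).
Proof.
have n0 : 0 < n%:R :> R by rewrite ltr0n.
have pr0 : 0 <= \prod_i rnorm (x i) by apply: prodr_ge0 => i _; exact: rnorm_ge0.
have -> : rnorm (lie_eval br x p) =
    n%:R^-1 * rnorm (word_sum (lie_series p) n (right_bracket br x)).
  rewrite magnus_eval.
  have -> : n%:R^-1 = ratr n%:R^-1 :> scalar_field R k by rewrite fmorphV rmorph_nat.
  by rewrite rnormZ_rat normfV normr_nat fmorphV rmorph_nat.
have -> : n`!%:R / n%:R ^+ 2 * \prod_i rnorm (x i) =
    n%:R^-1 * (n`!%:R * (n%:R^-1 * \prod_i rnorm (x i))).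
  by field; rewrite gt_eqF.
rewrite ler_wpM2l ?invr_ge0 ?ler0n//.
apply: (le_trans (rnorm_sum _ _ _)).
rewrite (bigID (fun w => perm_eq w (enum 'I_n)))/= [X in _ + X]big1 ?addr0; last first.
  by move=> w /magnus_coef0 ->; rewrite rmorph0 scale0r rnorm0.
have term w : perm_eq w (enum 'I_n) ->
    rnorm (ratr (lie_series p w) *: right_bracket br x w) <= n%:R^-1 * \prod_i rnorm (x i).
  move=> pw; rewrite rnormZ_rat.
  have -> : \prod_i rnorm (x i) = \prod_(i <- w) rnorm (x i).
    by rewrite (perm_big _ pw) big_enum.
  apply: ler_pM; rewrite ?rnorm_ge0 ?ler0q//.
    have -> : n%:R^-1 = ratr n%:R^-1 :> R by rewrite fmorphV rmorph_nat.
    by rewrite ler_rat magnus_coef_le.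
  apply: rnorm_right_bracket => //.
  by rewrite -size_eq0 (perm_size pw) size_enum_ord -lt0n.
apply: (le_trans (ler_sum _ (fun w pw => term w pw))).
rewrite big_const_seq -size_filter iter_addr_0 -[leLHS]mulr_natl.
rewrite ler_wpM2r ?mulr_ge0 ?invr_ge0// ler_nat.
by have := size_perm_words 'I_n; rewrite card_ord.
Qed.

Lemma magnus_eval_bounded_multilinear :
  bounded_multilinear (fun l : seq g => lie_eval br (fun a : 'I_n => nth 0 l a) p) n
    (n`!%:R / n%:R ^+ 2).
Proof.
split=> [|l1 a b l2 s|l s]; first by rewrite divr_ge0 ?exprn_ge0.
  have i0 : (size l1 < n)%N by rewrite -s ltnS leq_addr.
  rewrite !magnus_eval -scalerDr; congr (_ *: _).
  rewrite /word_sum -big_split; apply: eq_bigr => w _ /=.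
  have [pw|/magnus_coef0 ->] := boolP (perm_eq w (enum 'I_n)); last first.
    by rewrite rmorph0 !scale0r addr0.
  rewrite -scalerDr; congr (_ *: _); apply: (@right_bracketD _ _ _ _ _ _ _ _ (Ordinal i0)).
  - by rewrite (perm_uniq pw) enum_uniq.
  - by rewrite (perm_mem pw) mem_enum.
  - by rewrite /= !nth_cat ltnn subnn.
  move=> j ji; rewrite !nth_cat; case: ltnP => // lj.
  have jl : (j : nat) != size l1 by apply: contra ji => /eqP ji; apply/eqP/val_inj.
  by rewrite -(prednK (_ : 0 < j - size l1)%N)// subn_gt0 ltn_neqAle eq_sym jl.
apply: (le_trans (magnus_eval_le _)).
by rewrite (big_nth 0) s big_mkord.
Qed.

End MagnusPolynomials.

(** * Partitions into intervals *)

Section Partitions.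
Variable R : realType.
Implicit Types (I J K : interval R) (s t : seq (interval R)).

Definition before J K : bool := `[< forall x y, x \in J -> y \in K -> x < y >].

Definition covered s (x : R) : bool := has (fun J => x \in J) s.

Definition interval_partition I s : Prop :=
  (forall x, (x \in I) = covered s x) /\ pairwise before s.

Lemma ordered_partitionE I s : ordered_partition I s <-> interval_partition I s.
Proof.
have cov x : (\bigcup_(i in [set: 'I_(size s)]) [set` tnth (in_tuple s) i]) x <->
    covered s x.
  split=> [[i _ /= xi]|/hasP[J Js xJ]].
    by apply/hasP; exists (tnth (in_tuple s) i) => //; exact: mem_tnth.
  have /tnthP[i iJ] : J \in in_tuple s by [].
  by exists i => //=; rewrite -iJ.
split=> -[Is bs]; split.
- move=> x; apply/idP/idP => [xI|/cov]; last by rewrite -Is.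
  by apply/cov; rewrite -Is.
- apply/(pairwiseP I) => i j; rewrite !inE => si sj ij; apply/asboolP => x y xi yj.
  by apply: (bs (Ordinal si) (Ordinal sj)) => //; rewrite (tnth_nth I).
- by apply/seteqP; split=> x /=; [rewrite Is => /cov|move/cov; rewrite -Is].
- move=> i j x y ij; rewrite !(tnth_nth I) /=; have /pairwiseP-/(_ I i j) := bs.
  by rewrite !inE !ltn_ord => /(_ isT isT ij)/asboolP; apply.
Qed.

Lemma covered_cat s t x : covered (s ++ t) x = covered s x || covered t x.
Proof. exact: has_cat. Qed.

Lemma interval_partition1 I : interval_partition I [:: I].
Proof. by split=> // x; rewrite /covered /= orbF. Qed.

Lemma interval_partition_sub I s J x : interval_partition I s -> J \in s ->
  x \in J -> x \in I.
Proof. by move=> [Is _] Js xJ; rewrite Is; apply/hasP; exists J. Qed.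

Lemma interval_partition_cut I q s t :
  interval_partition (Order.meet I `]-oo, q]) s ->
  interval_partition (Order.meet I `]q, +oo[) t ->
  interval_partition I (s ++ t).
Proof.
move=> ps pt; split=> [x|].
  rewrite covered_cat -(proj1 ps) -(proj1 pt) !in_itvI !in_itv/= andbT -andb_orr.
  by case: leP; rewrite andbT.
rewrite pairwise_cat (proj2 ps) (proj2 pt) !andbT.
apply/allrelP => J K Js Kt; apply/asboolP => x y xJ yK.
have := interval_partition_sub ps Js xJ; have := interval_partition_sub pt Kt yK.
rewrite !in_itvI !in_itv/= andbT => /andP[_ qy] /andP[_ xq]; exact: le_lt_trans qy.
Qed.

Lemma covered_flatten s (u : interval R -> seq (interval R)) x :
  (forall J, J \in s -> forall x, (x \in J) = covered (u J) x) ->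
  covered (flatten (map u s)) x = covered s x.
Proof.
elim: s => [//|J s IH] us /=; rewrite covered_cat IH; last first.
  by move=> K Ks; apply: us; rewrite inE Ks orbT.
by rewrite -us ?mem_head.
Qed.

Lemma interval_partition_flatten I s (u : interval R -> seq (interval R)) :
  interval_partition I s ->
  (forall J, J \in s -> interval_partition J (u J)) ->
  interval_partition I (flatten (map u s)).
Proof.
move=> [Is bs] us; split=> [x|]; first by
  rewrite (covered_flatten (s := s)) ?Is// => J Js; case: (us _ Js).
elim: s bs us {Is} => [//|J s IH] /= /andP[Jb bs] us.
have us' K : K \in s -> interval_partition K (u K).
  by move=> Ks; apply: us; rewrite inE Ks orbT.
rewrite pairwise_cat IH// (proj2 (us J _)) ?mem_head// !andbT.
apply/allrelP => K L KJ /flatten_mapP[L' L's LL']; apply/asboolP => x y xK yL.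
move/allP: Jb => /(_ _ L's)/asboolP; apply.
  exact: (interval_partition_sub (us J (mem_head _ _)) KJ xK).
exact: (interval_partition_sub (us' _ L's) LL' yL).
Qed.

Lemma interval_partition_meet I s J : interval_partition I s ->
  (forall x, x \in J -> x \in I) ->
  interval_partition J [seq Order.meet J K | K <- s].
Proof.
move=> [Is bs] JI; split=> [x|].
  rewrite /covered has_map; apply/idP/hasP => [xJ|[K Ks]]; last first.
    by rewrite /= in_itvI => /andP[].
  have : covered s x by rewrite -Is JI.
  by case/hasP => K Ks xK; exists K => //=; rewrite in_itvI xJ.
rewrite pairwise_map; apply: sub_pairwise bs => K L /asboolP KL; apply/asboolP => x y.
by rewrite !in_itvI => /andP[_ xK] /andP[_ yL]; exact: KL.
Qed.

Definition nonempty J : bool := `[< exists x, x \in J >].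

(** On nonempty intervals [before] is a strict order, so a list sorted for it is
determined by its members. *)
Lemma sorted_nonempty_eq s t : pairwise before s -> pairwise before t ->
  {in nonempty, s =i t} ->
  [seq J <- s | nonempty J] = [seq J <- t | nonempty J].
Proof.
move=> bs bt st.
pose lt J K := [&& nonempty J, nonempty K & before J K].
have lt_sorted r : pairwise before r -> sorted lt [seq J <- r | nonempty J].
  move=> br; apply: pairwise_sorted.
  have : pairwise before [seq J <- r | nonempty J].
    by apply: subseq_pairwise br; exact: filter_subseq.
  elim: [seq J <- r | nonempty J] (filter_all nonempty r) => [//|J r' IH] /=.
  move=> /andP[nJ nr'] /andP[Jr' br'].
  rewrite IH// andbT; apply/allP => K Kr'.
  by rewrite /lt nJ (allP nr')// (allP Jr').
apply: (@irr_sorted_eq _ lt).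
- move=> K J L /and3P[nJ nK /asboolP JK] /and3P[_ nL /asboolP KL].
  apply/and3P; split=> //; apply/asboolP => x y xJ yL.
  by have /asboolP[z zK] := nK; exact: lt_trans (JK _ _ xJ zK) (KL _ _ zK yL).
- move=> J; apply/negP => /and3P[/asboolP[x xJ] _ /asboolP/(_ _ _ xJ xJ)].
  by rewrite ltxx.
- exact: lt_sorted.
- exact: lt_sorted.
- by move=> J; rewrite !mem_filter; case: (boolP (nonempty J)) => //= /st.
Qed.

End Partitions.

(** * Vector measures on intervals *)

Lemma cvg_seq_unique (K : numFieldType) (V : normedModType K) (u : nat -> V) (a b : V) :
  u @ \oo --> a -> u @ \oo --> b -> a = b.
Proof.
move=> ua ub; rewrite -(cvg_lim (@norm_hausdorff _ V) ua).
exact: (cvg_lim (@norm_hausdorff _ V) ub).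
Qed.

Section VectorMeasure.
Variables (R : realType) (k : scalar_kind).
Variables (V : normedModType (scalar_field R k)).
Variables (I : interval R) (alpha : set R -> V).
Hypothesis alpha_cont : continuous_measure I alpha.
Implicit Types (J K : interval R) (s t : seq (interval R)).

Let sub_I J := forall x, x \in J -> x \in I.

Lemma measure_set0 : alpha set0 = 0.
Proof.
have tI0 : trivIset setT (fun _ : nat => @set0 R).
  by apply/trivIsetP => i j _ _ _; exact: set0I.
have /cvgP := vmeasure_sigma_additive alpha_cont
  (fun=> measurable0) (fun=> @sub0set _ _) tI0.
by move=> /cvg_series_cvg_0; apply: cvg_seq_unique; exact: cvg_cst.
Qed.

Lemma measure_setU (A B : set R) : measurable A -> measurable B ->
  A `<=` [set` I] -> B `<=` [set` I] -> A `&` B = set0 ->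
  alpha (A `|` B) = alpha A + alpha B.
Proof.
move=> mA mB AI BI AB.
have h := vmeasure_sigma_additive alpha_cont (F := bigcup2 A B).
have {}h : series (fun m => alpha (bigcup2 A B m)) @ \oo --> alpha (A `|` B).
  rewrite -bigcup2E; apply: h.
  - by move=> [|[|m]]; [exact: mA|exact: mB|exact: measurable0].
  - by move=> [|[|]]//= ?; exact: sub0set.
  - by rewrite -trivIset_bigcup2.
move: h; rewrite -(cvg_shiftn 2) => /cvg_seq_unique; apply.
rewrite (_ : [sequence _]_n = cst (alpha A + alpha B)); first exact: cvg_cst.
apply/funext => n; rewrite /series /= addn2 big_nat_recl// big_nat_recl//= big1 ?addr0//.
by move=> i _; exact: measure_set0.
Qed.

Lemma measurable_covered s : measurable [set x | covered s x].
Proof.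
elim: s => [|J s IH]; first by rewrite (_ : [set _ | _] = set0)//; apply/seteqP; split.
rewrite (_ : [set _ | _] = [set` J] `|` [set x | covered s x]).
  by apply: measurableU => //; exact: measurable_itv.
by apply/seteqP; split=> x /= /orP.
Qed.

Lemma measure_partition J s : sub_I J -> interval_partition J s ->
  alpha [set` J] = \sum_(K <- s) alpha [set` K].
Proof.
move=> JI [Js bs].
have -> : [set` J] = [set x | covered s x].
  by apply/seteqP; split=> x /=; rewrite Js.
have {Js JI} : forall x, covered s x -> x \in I by move=> x; rewrite -Js; exact: JI.
elim: s bs => [|K s IH] /= bs sI.
  rewrite big_nil -measure_set0; congr alpha.
  by apply/seteqP; split.
case/andP: bs => Kb bs.
have KI x : x \in K -> x \in I by move=> xK; apply: sI; rewrite /= xK.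
have sI' x : covered s x -> x \in I by move=> xs; apply: sI; rewrite /= xs orbT.
rewrite big_cons -(IH bs sI') -measure_setU//.
- by congr alpha; apply/seteqP; split=> x /= /orP.
- exact: measurable_covered.
- apply/seteqP; split=> // x [/= xK] /hasP[L Ls xL].
  by have /asboolP/(_ _ _ xK xL) := allP Kb _ Ls; rewrite ltxx.
Qed.

(** Continuity from above: the differences of consecutive intervals are disjoint, and
their series telescopes.  The intersection is empty or a point, hence null. *)
Lemma measure_shrinking (J : nat -> interval R) :
  (forall m, sub_I (J m)) ->
  (forall m x, x \in J m.+1 -> x \in J m) ->
  (forall x y, (forall m, x \in J m) -> (forall m, y \in J m) -> x = y) ->
  alpha [set` J m] @[m --> \oo] --> (0 : V).
Proof.
move=> JI Jd J1.
have mJ m : measurable [set` J m] by exact: measurable_itv.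
pose E := \bigcap_m [set` J m].
pose D m := [set` J m] `\` [set` J m.+1].
have mE : measurable E by exact: bigcapT_measurable.
have aE : alpha E = 0.
  have [E0|/set0P[x Ex]] := eqVneq E set0; first by rewrite E0 measure_set0.
  have -> : E = [set x].
    apply/seteqP; split=> [y Ey|_ ->//]; apply: J1 => m; [exact: Ey|exact: Ex].
  by apply: (vmeasure_atomless alpha_cont); exact: (JI 0%N _ (Ex 0%N Logic.I)).
have Jle m p x : (m <= p)%N -> x \in J p -> x \in J m.
  by elim: p => [|p IH]; [case: m|rewrite leq_eqVlt => /orP[/eqP->//|/IH {}IH /Jd]].
have UD : \bigcup_m D m = [set` J 0%N] `\` E.
  apply/seteqP; split=> x.
    move=> [m _ [xm xm1]]; split; first exact: Jle xm.
    by move=> /(_ m.+1 Logic.I).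
  move=> [x0 xE].
  have ex : exists m, x \notin J m.
    apply: contrapT => nex; apply: xE => m _ /=; apply: contrapT => /negP xm.
    by apply: nex; exists m.
  case: (ex_minnP ex) => -[|m] xm mmin; first by rewrite x0 in xm.
  exists m => //; split; last exact/negP.
  by apply: contrapT => /negP /mmin; rewrite ltnn.
have cD : series (fun m => alpha (D m)) @ \oo --> alpha ([set` J 0%N] `\` E).
  rewrite -UD; apply: (vmeasure_sigma_additive alpha_cont).
  - by move=> m; exact: measurableD.
  - by move=> m x [xm _]; exact: JI xm.
  - apply/trivIsetP => i j _ _; wlog ij : i j / (i < j)%N => [H|].
      rewrite neq_lt => /orP[|] ij; [|rewrite setIC]; apply: H => //; by rewrite neq_lt ij ?orbT.
    move=> _; apply/seteqP; split=> // x [[_ xi] [xj _]]; apply: xi; exact: Jle xj.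
have tele N : series (fun m => alpha (D m)) N = alpha [set` J 0%N] - alpha [set` J N].
  rewrite /series/=; elim: N => [|N IH]; first by rewrite big_geq// subrr.
  rewrite big_nat_recr//= IH.
  have -> : [set` J N] = D N `|` [set` J N.+1].
    apply/seteqP; split=> x /=; last by move=> [[]//|/Jd].
    by move=> xm; case: (boolP (x \in J N.+1)) => xm1; [right|left; split=> //; apply/negP].
  rewrite measure_setU//.
  - by rewrite [X in _ - X]addrC opprD addrA subrK.
  - exact: measurableD.
  - by move=> x [/= /JI].
  - by move=> x /= /JI.
  - by apply/seteqP; split=> // x [[_ +] +].
have : alpha [set` J 0%N] - series (fun m => alpha (D m)) N @[N --> \oo] -->
    alpha [set` J 0%N] - alpha ([set` J 0%N] `\` E).
  by apply: cvgB => //; exact: cvg_cst.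
have -> : alpha [set` J 0%N] - alpha ([set` J 0%N] `\` E) = 0.
  have EJ : E `<=` [set` J 0%N] by move=> x /(_ 0%N Logic.I).
  rewrite -{1}(setDUK EJ) measure_setU ?aE ?add0r ?subrr//.
  - exact: measurableD.
  - by move=> x /EJ /JI.
  - by move=> x [/JI].
  - by rewrite setDIK.
by under eq_fun do rewrite tele opprB addrC subrK.
Qed.

Lemma rat_cut_unique (x y : R) :
  (forall q : rat, (x <= ratr q) = (y <= ratr q)) -> x = y.
Proof.
wlog xy : x y / x < y => [H xyq|].
  have [xy|yx|//] := ltgtP x y; first exact: H.
  by apply/esym/H => // q; rewrite xyq.
move=> xyq; have [q] := rat_in_itvoo xy; rewrite in_itv/= => /andP[xq qy].
by have := xyq q; rewrite (ltW xq) leNgt qy.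
Qed.

(** An interval with no such partition is cut at all rational numbers in turn,
keeping each time a half that still has none.  The nested intervals obtained meet
in at most one point, because rational numbers separate points, so their measures
tend to 0; but an interval of small measure is its own partition.  Cutting at
rationals treats bounded and unbounded intervals alike. *)
Lemma small_partition J (e : R) : 0 < e -> sub_I J ->
  exists s, interval_partition J s /\
    forall K, K \in s -> rnorm (alpha [set` K]) < e.
Proof.
move=> e0 JI; apply: contrapT => Jbad.
pose good K := exists s, interval_partition K s /\
    forall L, L \in s -> rnorm (alpha [set` L]) < e.
pose cut (m : nat) : R := ratr (odflt 0 (unpickle m)).
pose lo K m := Order.meet K `]-oo, cut m].
pose hi K m := Order.meet K `]cut m, +oo[.
pose half K m := if `[< good (lo K m) >] then hi K m else lo K m.
pose fix F m := if m is m'.+1 then half (F m') m' else J.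
have bad m : ~ good (F m).
  elim: m => [//|m IH] /=; rewrite /half; case: asboolP => // -[s [ps sl]] [t [pt tl]].
  apply: IH; exists (s ++ t); split; first exact: interval_partition_cut ps pt.
  by move=> K; rewrite mem_cat => /orP[/sl|/tl].
have FS m x : x \in F m.+1 -> x \in F m.
  by rewrite /= /half; case: asboolP => _; rewrite in_itvI => /andP[].
have FI m : sub_I (F m).
  by elim: m => [//|m IH] x /FS; exact: IH.
have F1 x y : (forall m, x \in F m) -> (forall m, y \in F m) -> x = y.
  move=> xF yF; apply: rat_cut_unique => q.
  (* The cut at the rational [q] is made at step [pickle q]. *)
  have [m <-] : exists m, cut m = ratr q by exists (pickle q); rewrite /cut pickleK.
  have := xF m.+1; have := yF m.+1.
  rewrite /= /half; case: asboolP => _; rewrite !in_itvI !in_itv/= ?andbT.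
    by move=> /andP[_ qy] /andP[_ qx]; rewrite !leNgt qy qx.
  by move=> /andP[_ ->] /andP[_ ->].
have /cvgrPdist_lt/(_ _ (real_scalar_gt0 k e0)) := measure_shrinking FI FS F1.
case=> m _ /(_ m (leqnn m)) /rnorm_lt_real; rewrite sub0r rnormN => Fm.
apply: (bad m); exists [:: F m]; split; first exact: interval_partition1.
by move=> K; rewrite inE => /eqP->.
Qed.

End VectorMeasure.

(** * Partitions of small mesh and the simplex integral *)

Section FinePartitions.
Variables (R : realType) (k : scalar_kind).
Variables (V : normedModType (scalar_field R k)).
Variables (I : interval R) (alpha : set R -> V).
Hypothesis alpha_cont : continuous_measure I alpha.
Implicit Types (J K : interval R) (s t : seq (interval R)).

Definition variation_sum s : R := \sum_(J <- s) rnorm (alpha [set` J]).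

Lemma variation_sum_le_variation J s : interval_partition J s ->
  ((variation_sum s)%:E <= measure_variation alpha J)%E.
Proof.
by move=> ps; apply: ereal_sup_ubound; exists s => //; exact/ordered_partitionE.
Qed.

Lemma variation_le J (B : R) :
  (forall s, interval_partition J s -> variation_sum s <= B) ->
  (measure_variation alpha J <= B%:E)%E.
Proof.
move=> sB; apply: ge_ereal_sup => _ [s /ordered_partitionE ps <-].
by rewrite lee_fin; exact: sB.
Qed.

Let v : R := fine (measure_variation alpha I).

Lemma variationE : measure_variation alpha I = v%:E.
Proof.
rewrite fineK// ge0_fin_numE ?(vmeasure_finite_variation alpha_cont)//.
apply: le_trans (variation_sum_le_variation (interval_partition1 I)).
by rewrite lee_fin; apply: sumr_ge0 => J _; exact: rnorm_ge0.
Qed.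

Lemma variation_sum_le s : interval_partition I s -> variation_sum s <= v.
Proof. by move=> /variation_sum_le_variation; rewrite variationE lee_fin. Qed.

Lemma variation_ge0 : 0 <= v.
Proof.
apply: le_trans (variation_sum_le (interval_partition1 I)).
by apply: sumr_ge0 => J _; exact: rnorm_ge0.
Qed.

Lemma variation_sum_flatten s (u : interval R -> seq (interval R)) :
  variation_sum (flatten (map u s)) = \sum_(J <- s) variation_sum (u J).
Proof. by rewrite /variation_sum big_flatten big_map. Qed.

Lemma rnorm_le_variation_sum J s : (forall x, x \in J -> x \in I) ->
  interval_partition J s -> rnorm (alpha [set` J]) <= variation_sum s.
Proof. by move=> JI ps; rewrite (measure_partition alpha_cont JI ps) rnorm_sum. Qed.

(** A partition whose variation sum is within [e] of the total variation has slack at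
most [e]: refining one member [K] raises the sum by at most [e], so the variation
of [K] exceeds the norm of its measure by at most [e].  It then suffices to refine
such a partition until all members have small measure, as this only raises the
sum. *)
Lemma exists_fine_partition (d : R) : 0 < d -> exists s, interval_partition I s /\
  forall J, J \in s -> (measure_variation alpha J < d%:E)%E.
Proof.
move=> d0; pose e := d / 3; have e0 : 0 < e by rewrite divr_gt0.
have [s0 ps0 sv] : exists2 s, interval_partition I s & v - e < variation_sum s.
  have : ((v - e)%:E < measure_variation alpha I)%E.
    by rewrite variationE lte_fin ltrBlDr ltrDl.
  move=> /ereal_sup_gt[_ [s /ordered_partitionE ps <-]]; rewrite lte_fin.
  by exists s.
have [u uP] : exists u : interval R -> seq (interval R),
    forall J, (forall x, x \in J -> x \in I) -> interval_partition J (u J) /\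
      forall K, K \in u J -> rnorm (alpha [set` K]) < e.
  have : forall J, exists s, (forall x, x \in J -> x \in I) -> interval_partition J s /\
      forall K, K \in s -> rnorm (alpha [set` K]) < e.
    move=> J; have [JI|nJI] := pselect (forall x, x \in J -> x \in I); last by exists [::].
    by have [s sP] := small_partition alpha_cont e0 JI; exists s.
  by case/choice => u uP; exists u.
have s0I J : J \in s0 -> forall x, x \in J -> x \in I.
  by move=> Js x; exact: interval_partition_sub ps0 Js.
pose s := flatten (map u s0).
have ps : interval_partition I s.
  by apply: interval_partition_flatten => // J /s0I /uP[].
have {}sv : v - e < variation_sum s.
  apply: (lt_le_trans sv); rewrite variation_sum_flatten.
  rewrite /variation_sum big_seq [leRHS]big_seq -/(variation_sum _); apply: ler_sum => J Js.
  by apply: rnorm_le_variation_sum; [exact: s0I|have [] := uP _ (s0I _ Js)].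
exists s; split=> // K Ks.
have KI x : x \in K -> x \in I by exact: interval_partition_sub ps Ks.
have Ke : rnorm (alpha [set` K]) < e.
  by move/flatten_mapP: Ks => [J Js KJ]; have [_] := uP _ (s0I _ Js); exact.
apply: (@le_lt_trans _ _ (2 * e)%:E); last by rewrite lte_fin /e; lra.
apply: variation_le => w pw.
(* The partition [w] of [K] is tested by putting it in the place of [K]. *)
pose u' J := if J == K then w else [:: J].
have ps' : interval_partition I (flatten (map u' s)).
  apply: interval_partition_flatten => // J _; rewrite /u'; case: eqP => [->//|_].
  exact: interval_partition1.
have := variation_sum_le ps'; rewrite variation_sum_flatten.
have Kw := rnorm_le_variation_sum KI pw.
have du J : rnorm (alpha [set` J]) <= variation_sum (u' J).
  rewrite /u'; case: eqP => [->//|_]; by rewrite /variation_sum big_seq1.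
have uK : u' K = w by rewrite /u' eqxx.
move: sv; rewrite {1}/variation_sum !(big_rem K Ks)/= uK.
have : \sum_(J <- rem K s) rnorm (alpha [set` J]) <= \sum_(J <- rem K s) variation_sum (u' J).
  exact: ler_sum.
by lra.
Qed.

Lemma fine_partitions_proper : ProperFilter (fine_partitions alpha I).
Proof.
apply: Build_ProperFilter_ex.
  move=> A [d d0 dA]; have [s [ps sd]] := exists_fine_partition d0.
  by exists s; apply: dA => //; exact/ordered_partitionE.
split.
- by exists 1.
- move=> A B [d d0 dA] [e e0 eB]; exists (Num.min d e); first by rewrite lt_min d0.
  move=> s ps sd; split; [apply: dA|apply: eB] => // J /sd /lt_le_trans; apply;
    by rewrite lee_fin ge_min lexx ?orbT.
- by move=> A B AB [d d0 dA]; exists d => // s ps sd; exact/AB/dA.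
Qed.

End FinePartitions.

Section SimplexIntegral.
Variables (R : realType) (k : scalar_kind).
Variables (V : normedModType (scalar_field R k)).
Variables (W : completeNormedModType (scalar_field R k)).
Variables (I : interval R) (alpha : set R -> V).
Hypothesis alpha_cont : continuous_measure I alpha.
Variables (n : nat) (P : ('I_n -> V) -> W) (M : R).
Hypothesis bP : bounded_multilinear (fun l => P (fun a => nth 0 l a)) n M.
Implicit Types (J K : interval R) (s t : seq (interval R)).

Let Q (l : seq V) : W := P (fun a => nth 0 l a).
Let values s : seq V := [seq alpha [set` J] | J <- s].
Let v : R := fine (measure_variation alpha I).

(** Increasing maps into the indices correspond to subsequences of length [n]. *)
Lemma simplex_sum_list s : simplex_sum P alpha s = list_simplex_sum Q n (values s).
Proof.
pose D := [pred f : {ffun 'I_n -> 'I_(size s)} |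
  [forall a : 'I_n, forall b : 'I_n, (a < b)%N ==> (f a < f b)%N]].
have -> : simplex_sum P alpha s =
    \sum_(u <- [seq [seq f a | a <- enum 'I_n]
                | f : {ffun 'I_n -> 'I_(size s)} <- enum D])
      Q [seq alpha [set` tnth (in_tuple s) i] | i <- u].
  rewrite big_map big_enum; apply: eq_bigr => f _; congr P; apply/funext => a.
  rewrite -map_comp (nth_map a) ?size_enum_ord ?ltn_ord//=.
  by rewrite nth_ord_enum.
rewrite /list_simplex_sum.
have -> : values s = [seq alpha [set` tnth (in_tuple s) i] | i <- enum 'I_(size s)].
  by rewrite (map_comp (fun J => alpha [set` J]) (tnth (in_tuple s))) map_tnth_enum.
rewrite subseqs_of_map [RHS]big_map; apply: perm_big; apply: uniq_perm.
- rewrite map_inj_uniq ?enum_uniq// => f h fh; apply/ffunP => a.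
  have nthE (f' : {ffun 'I_n -> 'I_(size s)}) : nth (f a) [seq f' b | b <- enum 'I_n] a = f' a.
    by rewrite (nth_map a) ?size_enum_ord ?ltn_ord// nth_ord_enum.
  by rewrite -[LHS]nthE fh nthE.
- by rewrite uniq_subseqs_of ?enum_uniq.
move=> u; rewrite mem_subseqs_of subseq_enum_ord.
apply/mapP/andP => [[f]|[su uS]].
  rewrite mem_enum inE => /forallP fD ->; rewrite size_map size_enum_ord; split=> //.
  have fS : {homo f : a b / (a < b)%N >-> (a < b)%N}.
    by move=> a b ab; have /forallP/(_ b)/implyP := fD a; apply.
  by apply: homo_sorted fS _ _; rewrite -subseq_enum_ord.
exists [ffun a => tnth (Tuple su) a].
  rewrite mem_enum inE; apply/forallP => a; apply/forallP => b; apply/implyP => ab.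
  have x0 := tnth (Tuple su) a; rewrite !ffunE !(tnth_nth x0)/=.
  apply: (sorted_ltn_nth _ _ uS) => //; first by move=> ? ? ?; exact: ltn_trans.
  - by rewrite inE (eqP su).
  - by rewrite inE (eqP su).
rewrite -[LHS](map_tnth_enum (Tuple su)).
by apply: eq_map => a; rewrite ffunE.
Qed.

Lemma total_norm_values s : total_norm (values s) = variation_sum alpha s.
Proof. by rewrite /total_norm /variation_sum big_map. Qed.

Lemma rnorm_simplex_sum_le s : interval_partition I s ->
  n`!%:R * rnorm (simplex_sum P alpha s) <= M * v ^+ n.
Proof.
move=> ps; rewrite simplex_sum_list; apply: (le_trans (list_simplex_sum_le _ bP)).
rewrite ler_wpM2l ?(bm_ge0 bP)// lerXn2r// ?nnegrE ?total_norm_ge0 ?variation_ge0//.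
by rewrite total_norm_values variation_sum_le.
Qed.

Let mesh s t : seq (interval R) :=
  flatten [seq [seq Order.meet J K | K <- t] | J <- s].

Lemma mesh_partition s t : interval_partition I s -> interval_partition I t ->
  interval_partition I (mesh s t).
Proof.
move=> ps pt; apply: interval_partition_flatten => // J Js.
by apply: interval_partition_meet pt _ => x; exact: interval_partition_sub ps Js.
Qed.

Lemma simplex_sum_mesh s t (d : R) : 0 <= d -> interval_partition I s -> interval_partition I t ->
  (forall J, J \in s -> (measure_variation alpha J < d%:E)%E) ->
  rnorm (simplex_sum P alpha s - simplex_sum P alpha (mesh s t))
  <= M * v ^+ (n - 2) * (d * v).
Proof.
move=> d0 ps pt sd.
have sub J x : J \in s -> x \in J -> x \in I by move=> Js; exact: interval_partition_sub ps Js.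
have pJ J : J \in s -> interval_partition J [seq Order.meet J K | K <- t].
  by move=> Js; apply: interval_partition_meet pt _ => x; exact: sub.
pose ss := [seq values [seq Order.meet J K | K <- t] | J <- s].
have vs : values s = [seq \sum_(x <- u) x | u <- ss].
  rewrite /ss -map_comp; apply/eq_in_map => J Js /=.
  by rewrite big_map -(measure_partition alpha_cont _ (pJ J Js))// => x; exact: sub.
have vm : values (mesh s t) = flatten ss by rewrite /values map_flatten -map_comp.
have tm : total_norm (flatten ss) <= v.
  by rewrite -vm total_norm_values variation_sum_le//; exact: mesh_partition.
have v0 := variation_ge0 alpha_cont.
have dss u : u \in ss -> total_norm u <= d.
  case/mapP => J Js ->; rewrite total_norm_values -lee_fin.
  exact: le_trans (variation_sum_le_variation alpha (pJ J Js)) (ltW (sd J Js)).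
rewrite !simplex_sum_list vs vm.
apply: (le_trans (list_simplex_sum_blocks (v1 := [::]) bP tm dss)).
by rewrite !ler_wpM2l// mulr_ge0 ?exprn_ge0 ?(bm_ge0 bP).
Qed.

(** The two meshes list the same nonempty intervals in the same order, and the empty
ones have measure zero. *)
Lemma simplex_sum_meshC s t : interval_partition I s -> interval_partition I t ->
  simplex_sum P alpha (mesh s t) = simplex_sum P alpha (mesh t s).
Proof.
move=> ps pt.
have valuesF r : [seq x <- values r | x != 0]
    = [seq x <- values [seq J <- r | nonempty J] | x != 0].
  rewrite !filter_map -filter_predI; congr map; apply: eq_filter => J /=.
  rewrite andb_idr// => aJ; apply/asboolP; apply: contrapT => nJ; move/eqP: aJ; apply.
  rewrite -(measure_set0 alpha_cont); congr alpha.
  by apply/seteqP; split=> // x xJ; apply: nJ; exists x.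
rewrite !simplex_sum_list -(list_simplex_sum_filter _ bP) -[RHS](list_simplex_sum_filter _ bP).
rewrite valuesF [in RHS]valuesF; congr (list_simplex_sum _ _ [seq x <- values _ | _]).
have sub J s1 t1 : J \in mesh s1 t1 -> J \in mesh t1 s1.
  case/flatten_mapP => K Ks /mapP[L Lt ->]; apply/flatten_mapP; exists L => //.
  by apply/mapP; exists K => //; rewrite meetC.
apply: sorted_nonempty_eq; [exact: (mesh_partition ps pt).2|exact: (mesh_partition pt ps).2|].
by move=> J _; apply/idP/idP; exact: sub.
Qed.

Lemma simplex_sum_dist s t (d : R) : 0 <= d -> interval_partition I s -> interval_partition I t ->
  (forall J, J \in s -> (measure_variation alpha J < d%:E)%E) ->
  (forall J, J \in t -> (measure_variation alpha J < d%:E)%E) ->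
  rnorm (simplex_sum P alpha s - simplex_sum P alpha t)
  <= 2 * (M * v ^+ (n - 2) * (d * v)).
Proof.
move=> d0 ps pt sd td; rewrite -(subrKA (simplex_sum P alpha (mesh s t))).
apply: (le_trans (rnormD _ _)).
rewrite [2 * _]mulrDl mul1r lerD ?simplex_sum_mesh//.
by rewrite simplex_sum_meshC// rnorm_distC simplex_sum_mesh.
Qed.

(** The simplex sums are Cauchy along the fine partitions and the space is complete. *)
Lemma simplex_sum_cvg :
  simplex_sum P alpha s @[s --> fine_partitions alpha I] --> simplex_integral P alpha I.
Proof.
have FP := fine_partitions_proper alpha_cont.
apply: cauchy_cvg; apply: cauchy_exP => e e0.
have v0 := variation_ge0 alpha_cont.
pose C := 2 * (M * v ^+ (n - 2) * v).
have C0 : 0 <= C by rewrite !mulr_ge0 ?exprn_ge0 ?(bm_ge0 bP).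
have r0 := scalar_re_gt0 e0.
pose d := scalar_re e / (C + 1).
have d0 : 0 < d by rewrite divr_gt0// ltr_wpDl.
have [s0 [ps0 sd0]] := exists_fine_partition alpha_cont d0.
exists (simplex_sum P alpha s0); exists d => // t /ordered_partitionE pt td.
rewrite /= -ball_normE/=; apply: rnorm_lt => //.
apply: (le_lt_trans (simplex_sum_dist (ltW d0) ps0 pt sd0 td)).
rewrite (_ : 2 * _ = C * d); last by rewrite /C; ring.
by rewrite /d mulrA ltr_pdivrMr ?ltr_wpDl// mulrC ltr_pM2l// ltrDl.
Qed.

Lemma rnorm_simplex_integral_le :
  n`!%:R * rnorm (simplex_integral P alpha I) <= M * v ^+ n.
Proof.
have FP := fine_partitions_proper alpha_cont.
rewrite mulrC -ler_pdivlMr ?ltr0n ?fact_gt0//; apply/ler_addgt0Pr => e e0.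
have /cvgrPdist_lt/(_ _ (real_scalar_gt0 k e0)) := simplex_sum_cvg.
move=> [d d0 dP].
have [s [ps sd]] := exists_fine_partition alpha_cont d0.
have /rnorm_lt_real he := dP s (proj2 (ordered_partitionE _ _) ps) sd.
have := rnormD (simplex_integral P alpha I - simplex_sum P alpha s) (simplex_sum P alpha s).
rewrite subrK => /le_trans; apply; rewrite addrC lerD ?(ltW he)//.
by rewrite ler_pdivlMr ?ltr0n ?fact_gt0// mulrC rnorm_simplex_sum_le.
Qed.

End SimplexIntegral.

(** * Taylor coefficients of 2 - 2 sqrt (1 - T) *)

Section SquareRootTaylor.
Variables (R : realType) (v : R).
Implicit Types T : R.

(** The product of 1/2, 3/2, ..., (2m-1)/2, which is the (m+1)-st derivative at 0 of
2 - 2 sqrt (1 - T). *)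
Fixpoint sqrt_taylor (m : nat) : R :=
  if m is m'.+1 then sqrt_taylor m' * ((2 * m' + 1)%:R / 2) else 1.

Let u T : R := (Num.sqrt (1 - T * v))^-1.

Lemma is_derive_invsqrt T : 0 < 1 - T * v -> is_derive T 1 u (v / 2 * u T ^+ 3).
Proof.
move=> T1.
have d1 : is_derive T 1 (fun T => 1 - T * v) (- v).
  apply: is_derive_eq.
  rewrite /GRing.scale/=; ring.
have d2 := is_derive1_sqrt T1.
have d3 : is_derive T 1 (fun T => Num.sqrt (1 - T * v)) _ :=
  @is_derive1_comp _ Num.sqrt (fun T => 1 - T * v) _ _ _ d2 d1.
have s0 : Num.sqrt (1 - T * v) != 0 by rewrite gt_eqF// sqrtr_gt0.
apply: (is_derive_eq (@is_deriveV _ (fun T => Num.sqrt (1 - T * v)) _ _ _ s0 d3)).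
by rewrite /GRing.scale/= /u; field.
Qed.

Lemma is_derive_sqrt T : 0 < 1 - T * v ->
  is_derive T 1 (fun T => 2 - 2 * Num.sqrt (1 - T * v)) (v * u T).
Proof.
move=> T1.
have d1 : is_derive T 1 (fun T => 1 - T * v) (- v).
  apply: is_derive_eq.
  rewrite /GRing.scale/=; ring.
have d2 := is_derive1_sqrt T1.
have d3 : is_derive T 1 (fun T => Num.sqrt (1 - T * v)) _ :=
  @is_derive1_comp _ Num.sqrt (fun T => 1 - T * v) _ _ _ d2 d1.
have s0 : Num.sqrt (1 - T * v) != 0 by rewrite gt_eqF// sqrtr_gt0.
apply: is_derive_eq.
by rewrite /GRing.scale/= /u; field.
Qed.

(** With u = (1 - T v)^(-1/2) one has u' = (v/2) u^3, so every derivative is a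
multiple of an odd power of u. *)
Lemma derive1n_sqrt m T : 0 < 1 - T * v ->
  ((fun T => 2 - 2 * Num.sqrt (1 - T * v))^`(m.+1))%classic T
  = sqrt_taylor m * v ^+ m.+1 * u T ^+ (2 * m + 1).
Proof.
elim: m T => [|m IH] T T1.
  rewrite derive1n1 derive1E; have d := is_derive_sqrt T1.
  by rewrite derive_val mul1r expr1.
rewrite derive1nS derive1E.
rewrite (@near_eq_derive _ _ _ _ (fun T => sqrt_taylor m * v ^+ m.+1 * u T ^+ (2 * m + 1))).
  have d := is_derive_invsqrt T1.
  have d2 : is_derive T 1 (fun T => sqrt_taylor m * v ^+ m.+1 * u T ^+ (2 * m + 1))
     (sqrt_taylor m.+1 * v ^+ m.+2 * u T ^+ (2 * m.+1 + 1)).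
    rewrite (_ : (fun _ => _) = (sqrt_taylor m * v ^+ m.+1) \*: u ^+ (2 * m + 1)).
      apply: (is_derive_eq (is_deriveZ _ (is_deriveX _ d))).
    rewrite [in RHS](_ : (2 * m.+1 + 1 = (2 * m) + 3)%N); last lia.
    rewrite /GRing.scale/= addn1/= [in RHS]exprD (exprS v m.+1); ring.
      by apply/funext => t; rewrite exprfctE.
  by rewrite derive_val.
near=> t; apply: IH.
near: t; rewrite near_simpl.
have c : {for T, continuous (fun T => 1 - T * v)}.
  by apply: cvgB; [exact: cvg_cst|apply: cvgMl; exact: cvg_id].
exact: (c _ (lt_nbhsr T1)).
Unshelve. all: by end_near. Qed.

Lemma taylor_coef_sqrt m :
  taylor_coef (fun T => 2 - 2 * Num.sqrt (1 - T * v)) m.+1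
  = sqrt_taylor m / m.+1`!%:R * v ^+ m.+1.
Proof.
rewrite /taylor_coef derive1n_sqrt ?mul0r ?subr0//.
by rewrite /u mul0r subr0 sqrtr1 invr1 expr1n mulr1 mulrAC.
Qed.

(** The ratio of consecutive coefficients is (2n-1) / (2(n+1)) with n = m+1, and
(2n-1) (n+1) >= 2 n^2. *)
Lemma invsqr_le_sqrt_taylor m : (m.+1%:R ^+ 2)^-1 <= sqrt_taylor m / m.+1`!%:R.
Proof.
elim: m => [|m IH] /=; first by rewrite expr1n factS fact0 divr1 invr1.
rewrite factS [(m.+2 * _)%:R]natrM [(m.+2%:R * _)^-1]invfM.
apply: (le_trans (y := (m.+1%:R ^+ 2)^-1 * ((2 * m + 1)%:R / 2 / m.+2%:R))).
  have m1 : 0 < m.+1%:R :> R by rewrite ltr0n.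
  have -> : (2 * m + 1)%:R = 2 * m.+1%:R - 1 :> R.
    by apply/eqP; rewrite -subr_eq opprK natr1 -natrM; apply/eqP; congr (_%:R); lia.
  have -> : m.+2%:R = m.+1%:R + 1 :> R by rewrite natr1.
  have m2 : 1 <= m.+1%:R :> R by rewrite ler1n.
  set a := m.+1%:R in m1 m2 *.
  rewrite -subr_ge0.
  have -> : (a ^+ 2)^-1 * ((2 * a - 1) / 2 / (a + 1)) - ((a + 1) ^+ 2)^-1
    = (a - 1) / (2 * a ^+ 2 * (a + 1) ^+ 2).
    by field; rewrite !gt_eqF//; nra.
  by rewrite divr_ge0 ?subr_ge0// !mulr_ge0 ?exprn_ge0//; lra.
rewrite [in leRHS](mulrC _^-1) [leRHS]mulrACA; apply: ler_wpM2r => //.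
Qed.

End SquareRootTaylor.

(** * The convergence estimate *)

Theorem proposition3p3 (R : realType) (k : scalar_kind)
    (g : completeNormedModType (scalar_field R k)) (br : {bilinear g -> g -> g})
    (br_lie : lie_bracket br) (br_norm : banach_lie_norm br)
    (I : interval R) (alpha : set R -> g)
    (alpha_cont : continuous_measure I alpha)
    (mu : forall n : nat, lie_poly n) (mu_magnus : forall n, magnus_poly (mu n)) :
  (forall n : nat, (1 <= n)%N ->
     rnorm (magnus_term br (mu n) alpha I)
     <= taylor_coef
          (fun T : R => 2 - 2 * Num.sqrt (1 - T * fine (measure_variation alpha I)))
          n)
  /\
  ((measure_variation alpha I < 1)%E ->
   (\sum_(1 <= n <oo) (rnorm (magnus_term br (mu n) alpha I))%:E < +oo)%E).
Proof.
set v := fine _.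
have v0 : 0 <= v := variation_ge0 alpha_cont.
have term_le n : (1 <= n)%N ->
    rnorm (magnus_term br (mu n) alpha I) <= (n%:R ^+ 2)^-1 * v ^+ n.
  move=> n1.
  have := @rnorm_simplex_integral_le _ _ _ _ _ _ alpha_cont _
    (fun x => lie_eval br x (mu n)) _
    (magnus_eval_bounded_multilinear br_lie br_norm n1 (mu_magnus n)).
  by rewrite -!mulrA ler_pM2l// ltr0n fact_gt0.
split=> [[//|m] _|vI].
  apply: (le_trans (term_le m.+1 isT)).
  by rewrite taylor_coef_sqrt ler_wpM2r ?exprn_ge0// invsqr_le_sqrt_taylor.
have v1 : v < 1 by move: vI; rewrite (variationE alpha_cont) lte_fin.
have term_geo n : (1 <= n)%N -> rnorm (magnus_term br (mu n) alpha I) <= v ^+ n.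
  move=> n1; apply: (le_trans (term_le n n1)).
  rewrite ler_piMl ?exprn_ge0// invf_le1 ?exprn_gt0 ?ltr0n//.
  by rewrite exprn_ege1// ler1n.
have partial n : \sum_(1 <= i < n) rnorm (magnus_term br (mu i) alpha I) <= (1 - v ^+ n) / (1 - v).
  have w0 : 0 < 1 - v by rewrite subr_gt0.
  elim: n => [|[|n] IH]; first by rewrite big_geq// expr0 subrr mul0r.
    by rewrite big_geq// expr1 divff ?gt_eqF.
  rewrite big_nat_recr//=; apply: (le_trans (lerD IH (term_geo n.+1 isT))).
  rewrite le_eqVlt; apply/orP; left; apply/eqP; rewrite (exprS v n.+1).
  by field; rewrite gt_eqF.
apply: (@le_lt_trans _ _ ((1 - v)^-1)%:E); last exact: ltry.
apply: lime_le.
  by apply: is_cvg_nneseries => n _ _; rewrite lee_fin rnorm_ge0.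
apply: nearW => n; rewrite sumEFin lee_fin; apply: (le_trans (partial n)).
by rewrite ler_piMl ?invr_ge0 ?subr_ge0 ?(ltW v1)// gerBl exprn_ge0.
Qed.
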